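(* Let $X=(X(n))_{n\in\mathbb{Z}_+}$ be a standard subproduct system such that $E=X(1)$ is a finite dimensional Hilbert space, and let $T$ be a completely contractive, covariant representation of $X$. If $T$ is pure, then the following conditions are equivalent: (1) $T$ extends to a $C^*$-representation. (2) $T$ is relatively isometric.
   Context: Here $\mathcal{M}=\mathbb{C}$ and all $X(n)$ are finite dimensional Hilbert spaces. Hilbert spaces are complex, inner products linear in the second variable; all representations are nondegenerate. Standard subproduct system (in this case): a family $X=(X(n))_{n\in\mathbb{Z}_+}$ of Hilbert spaces with $X(0)=\mathbb{C}$ and $X(n+m)$ a closed subspace of $X(n)\otimes X(m)$ for all $n,m$ (with $\mathbb{C}\otimes X(n)$, $X(n)\otimes\mathbb{C}$ identified with $X(n)$). Put $E=X(1)$; then $X(n)\subseteq E^{\otimes n}$ ($E^{\otimes 0}=\mathbb{C}$), and $p_n\in B(E^{\otimes n})$ is the orthogonal projection onto $X(n)$. Completely contractive, covariant representation of $X$ on a Hilbert space $\mathcal{H}$: a family $T=(T_n)_{n\in\mathbb{Z}_+}$ of linear maps $T_n:X(n)\to B(\mathcal{H})$ such that $\sigma:=T_0$ is the nondegenerate representation $c\mapsto cI_{\mathcal{H}}$ of $\mathbb{C}$; each $T_n$ is completely contractive, where $X(n)$ carries its (column) operator space structure as a corner of its linking algebra, equivalently the map $\widetilde{T}_n:X(n)\otimes\mathcal{H}\to\mathcal{H}$, $\widetilde{T}_n(\zeta\otimes h)=T_n(\zeta)h$, is a contraction; and $T_{n+m}(p_{n+m}(\zeta\otimes\eta))=T_n(\zeta)T_m(\eta)$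 for all $\zeta\in X(n)$, $\eta\in X(m)$. $T$ is pure if $\widetilde{T}_n\widetilde{T}_n^*\to0$ in the strong operator topology. $\Delta_*:=(I_{\mathcal{H}}-\widetilde{T}_1\widetilde{T}_1^* )^{1/2}$. $T$ is relatively isometric if all the maps $\widetilde{T}_n$, $n\in\mathbb{Z}_+$, are partial isometries and one (equivalently, both) of the following conditions holds: (a) $X(n)\otimes\operatorname{Im}\Delta_*\subseteq\operatorname{Im}\widetilde{T}_n^*$ for all $n\in\mathbb{Z}_+$; (b) $\Delta_*T_n(\zeta)^*T_n(\zeta)\Delta_*=\|\zeta\|^2\Delta_*$ for all $n\in\mathbb{Z}_+$, $\zeta\in X(n)$. $X$-Fock space and shift: $\mathcal{F}_X=\bigoplus_{n\in\mathbb{Z}_+}X(n)$, and for $\zeta\in X(n)$, $S_n(\zeta)\in B(\mathcal{F}_X)$ is given by $S_n(\zeta)\eta=p_{n+m}(\zeta\otimes\eta)$ for $\eta\in X(m)$. The Toeplitz algebra $\mathcal{T}(X)$ is the $C^*$-subalgebra of $B(\mathcal{F}_X)$ generated by all $S_n(\zeta)$. $T$ extends to a $C^*$-representation if there is a $C^*$-representation $\pi$ of $\mathcal{T}(X)$ on $\mathcal{H}$ with $\pi(S_n(\zeta))=T_n(\zeta)$ for all $n\in\mathbb{Z}_+$, $\zeta\in X(n)$. *)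

(* Defs.v *)
From HB Require Import structures.
From mathcomp Require Import all_boot all_order all_algebra.
From mathcomp Require Import complex.
From mathcomp Require Import all_classical all_reals all_analysis.
Set Implicit Arguments.
Unset Strict Implicit.
Unset Printing Implicit Defensive.
Import Order.TTheory GRing.Theory Num.Theory.
Import numFieldNormedType.Exports.
Local Open Scope classical_set_scope.
Local Open Scope complex_scope.
Local Open Scope ring_scope.

(* The inner product is linear in its second argument. *)
HB.mixin Record hasInner (R : realType) V & CompleteNormedModule R[i] V := {
  inner : V -> V -> R[i];
  inner_linearr : forall z : V, scalar (inner z);
  inner_conj : forall x y : V, inner y x = (inner x y)^*;
  inner_norm : forall x : V, inner x x = `|x| ^+ 2
}.

#[short(type="hilbertType")]
HB.structure Definition Hilbert (R : realType) :=
  {V of hasInner R V & CompleteNormedModule R[i] V}.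

Section Hilbert_spaces.
Context {R : realType}.
Implicit Types V W : hilbertType R.

Definition finite_dim V : Prop :=
  exists (d : nat) (b : 'I_d -> V),
    forall x, exists c : 'I_d -> R[i], x = \sum_(i < d) c i *: b i.

Definition closed_subspace V (S : set V) : Prop :=
  [/\ S 0, forall (c : R[i]) x y, S x -> S y -> S (c *: x + y) & closed S].

Definition closed_span V (A : set V) : set V := smallest (@closed_subspace V) A.

Definition isometric_embedding V W (f : V -> W) : Prop :=
  linear f /\ forall x y, inner (f x) (f y) = inner x y.

Definition bounded_op V W (f : V -> W) : Prop := linear f /\ continuous f.

(* Junk value 0 when there is no adjoint; every bounded operator has one. *)
Definition adj V W (f : V -> W) : W -> V :=
  xget (fun=> 0) [set g : W -> V | forall x y, inner (f x) y = inner x (g y)].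

Definition positive_op V (f : V -> V) : Prop :=
  bounded_op f /\ forall x, 0 <= inner x (f x).

(* Junk value 0 when [f] is not positive. *)
Definition sqrt_op V (f : V -> V) : V -> V :=
  xget (fun=> 0) [set g : V -> V | positive_op g /\ g \o g = f].

Definition partial_isometry V W (f : V -> W) : Prop :=
  bounded_op f /\ forall x, (forall z, f z = 0 -> inner z x = 0) -> `|f x| = `|x|.

Definition cstar_subalgebra V (A : set (V -> V)) : Prop :=
  [/\ forall a, A a -> bounded_op a,
      A 0 /\ (forall (c : R[i]) a b, A a -> A b -> A (c *: a + b)),
      forall a b, A a -> A b -> A (a \o b),
      forall a, A a -> A (adj a)
    & (* closed for the operator norm *)
      forall a, bounded_op a ->
        (forall eps : R[i], 0 < eps ->
           exists2 b, A b & forall x, `|a x - b x| <= eps * `|x|) -> A a].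

Definition cstar_generated V (G : set (V -> V)) : set (V -> V) :=
  smallest (@cstar_subalgebra V) G.

(* Nondegenerate representations of [A] on [W]; only the values of [pi] on [A]
   are relevant. *)
Definition cstar_representation V W (A : set (V -> V))
    (pi : (V -> V) -> (W -> W)) : Prop :=
  [/\ forall a, A a -> bounded_op (pi a),
      forall (c : R[i]) a b, A a -> A b -> pi (c *: a + b) = c *: pi a + pi b,
      forall a b, A a -> A b -> pi (a \o b) = pi a \o pi b,
      forall a, A a -> pi (adj a) = adj (pi a)
    & closed_span [set y | exists a x, A a /\ y = pi a x] = setT].

End Hilbert_spaces.

(* Hilbert space tensor products, direct sums and tensor powers are given by
   the properties that determine them up to a unique unitary compatible with
   the structure maps; a structure below is one model of the construction. *)
Record hilbert_tensor (R : realType) (V W : hilbertType R) := HilbertTensor {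
  ht_space :> hilbertType R;
  tens : V -> W -> ht_space;
  tens_linearl : forall w, linear (tens^~ w);
  tens_linearr : forall v, linear (tens v);
  tens_inner : forall v v' w w',
    inner (tens v w) (tens v' w') = inner v v' * inner w w';
  tens_total : closed_span [set t | exists v w, t = tens v w] = setT
}.

Record hilbert_sum (R : realType) (V : nat -> hilbertType R) := HilbertSum {
  hs_space :> hilbertType R;
  hs_in : forall n, V n -> hs_space;
  hs_in_isometric : forall n, isometric_embedding (@hs_in n);
  hs_in_orthogonal : forall n m (x : V n) (y : V m),
    n <> m -> inner (hs_in x) (hs_in y) = 0;
  hs_in_total : closed_span [set t | exists n (x : V n), t = hs_in x] = setT
}.

Definition ord_cat (A : Type) n m (v : 'I_n -> A) (w : 'I_m -> A)
    (k : 'I_(n + m)) : A :=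
  match fintype.split k with inl i => v i | inr j => w j end.

(* The spaces E^{(x) n}: [tpure v] is v_0 (x) ... (x) v_{n-1}, and [tmul] is
   the identification of E^{(x) n} (x) E^{(x) m} with E^{(x) (n + m)}. *)
Record tensor_powers (R : realType) (E : hilbertType R) := TensorPowers {
  tpow :> nat -> hilbertType R;
  tpure : forall n, ('I_n -> E) -> tpow n;
  tpure_linear : forall n (v : 'I_n -> E) (i : 'I_n),
    linear (fun x : E => tpure (fun j => if j == i then x else v j));
  tpure_inner : forall n (v w : 'I_n -> E),
    inner (tpure v) (tpure w) = \prod_(i < n) inner (v i) (w i);
  tpure_total : forall n,
    closed_span [set t | exists v : 'I_n -> E, t = tpure v] = setT;
  tmul : forall n m, tpow n -> tpow m -> tpow (n + m);
  tmul_linearl : forall n m (y : tpow m), linear (fun x : tpow n => tmul x y);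
  tmul_linearr : forall n m (x : tpow n), linear (fun y : tpow m => tmul x y);
  tmul_inner : forall n m (x x' : tpow n) (y y' : tpow m),
    inner (tmul x y) (tmul x' y') = inner x x' * inner y y';
  tmul_pure : forall n m (v : 'I_n -> E) (w : 'I_m -> E),
    tmul (tpure v) (tpure w) = tpure (ord_cat v w)
}.

(* The unit 1 of E^{(x) 0} = C. *)
Definition tone (R : realType) (E : hilbertType R) (P : tensor_powers E) : P 0%N :=
  tpure P (fun i : 'I_0 => 0).

(* Standard subproduct systems with X(1) = E. The subspace X(n) of E^{(x) n} is
   a Hilbert space with an isometric inclusion [sincl] (whose range is closed,
   X(n) being complete). *)
Record subproduct_system (R : realType) (E : hilbertType R)
    (P : tensor_powers E) := SubproductSystem {
  sspace :> nat -> hilbertType R;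
  sincl : forall n, sspace n -> P n;
  sincl_isometric : forall n, isometric_embedding (@sincl n);
  sincl0 : range (@sincl 0%N) = setT;
  sincl1 : range (@sincl 1%N) = setT;
  sincl_mul : forall n m,
    range (@sincl (n + m)%N) `<=`
    closed_span [set t | exists (x : sspace n) (y : sspace m),
                           t = tmul (sincl x) (sincl y)]
}.

Section Representations.
Context {R : realType} {E : hilbertType R} {P : tensor_powers E}.
Context (X : subproduct_system P).

(* The orthogonal projection p_n, with values in the Hilbert space X(n). *)
Definition sproj n (t : P n) : X n :=
  xget 0 [set x : X n | forall y : X n, inner (sincl y) (t - sincl x) = 0].

(* p_{n+m}(x (x) y), as an element of X(n+m). *)
Definition smul n m (x : X n) (y : X m) : X (n + m)%N :=
  sproj (tmul (sincl x) (sincl y)).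

Section Representation.
Context {H : hilbertType R}.

(* The norm of a k x k matrix z over V = B(C, V) with its column operator space
   structure is the norm of the operator z : C^k -> V^k, whose upper bounds are
   the numbers c below. *)
Definition completely_contractive (V : hilbertType R) (T : V -> H -> H) : Prop :=
  forall (k : nat) (z : 'M[V]_k) (c : R[i]), 0 <= c ->
    (forall a : 'I_k -> R[i],
       \sum_i `|\sum_j a j *: z i j| ^+ 2 <= c ^+ 2 * \sum_j `|a j| ^+ 2) ->
    forall h : 'I_k -> H,
      \sum_i `|\sum_j T (z i j) (h j)| ^+ 2 <= c ^+ 2 * \sum_j `|h j| ^+ 2.

Record cc_covariant_representation (T : forall n, X n -> H -> H) : Prop := {
  rep_bounded : forall n (x : X n), bounded_op (T n x);
  rep_linear : forall n, linear (T n);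
  rep0 : forall (c : R[i]) (x : X 0%N),
    sincl x = c *: tone P -> T 0%N x = (fun h => c *: h);
  rep_cc : forall n, completely_contractive (T n);
  rep_mul : forall n m (x : X n) (y : X m),
    T (n + m)%N (smul x y) = T n x \o T m y
}.

Context (XH : forall n, hilbert_tensor (X n) H) (T : forall n, X n -> H -> H).

(* The map X(n) (x) H -> H extending x (x) h |-> T_n(x) h. *)
Definition rep_tilde n : XH n -> H :=
  xget (fun=> 0) [set f : XH n -> H |
    bounded_op f /\ forall x h, f (tens (XH n) x h) = T x h].

Definition pure_rep : Prop :=
  forall h : H, (fun n => rep_tilde (adj (@rep_tilde n) h)) @ \oo --> (0 : H).

Definition Delta_star : H -> H :=
  sqrt_op (fun h : H => h - rep_tilde (adj (@rep_tilde 1%N) h)).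

Definition rel_isometric_a : Prop := forall n,
  closed_span [set t | exists (x : X n) (h : H), t = tens (XH n) x (Delta_star h)]
  `<=` range (adj (@rep_tilde n)).

Definition rel_isometric_b : Prop := forall n (x : X n) (h : H),
  Delta_star (adj (T x) (T x (Delta_star h))) = `|x| ^+ 2 *: Delta_star h.

Definition relatively_isometric : Prop :=
  (forall n, partial_isometry (@rep_tilde n)) /\
  (rel_isometric_a \/ rel_isometric_b).

End Representation.

(* [F] is a model of the X-Fock space. *)
Context (F : hilbert_sum X).

Definition fock_shift n (x : X n) : F -> F :=
  xget (fun=> 0) [set S : F -> F |
    bounded_op S /\ forall m (y : X m), S (hs_in F y) = hs_in F (smul x y)].

Definition toeplitz : set (F -> F) :=
  cstar_generated [set S | exists n (x : X n), S = fock_shift x].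

Definition extends_to_cstar_representation (H : hilbertType R)
    (T : forall n, X n -> H -> H) : Prop :=
  exists pi : (F -> F) -> (H -> H),
    cstar_representation toeplitz pi /\
    forall n (x : X n), pi (fock_shift x) = T n x.

End Representations.

(* Main.v *)
From HB Require Import structures.
Require Import Defs.
From mathcomp Require Import all_boot all_order all_algebra.
From mathcomp Require Import complex.
From mathcomp Require Import all_classical all_reals all_analysis.
From mathcomp Require Import ring.

(* (1) => (2). Since X(n + m) lies in X(n) (x) X(m), the operator
   S~_n S~_n^* = sum_e S_n(e) S_n(e)^*, e in a finite frame of X(n), is the
   projection of F_X onto the sum of the X(m), m >= n. Applying pi, every
   T~_n T~_n^* is a projection and Delta is the image of the projection p onto
   X(0); condition (b) is the image of p S_n(x)^* S_n(x) p = |x|^2 p.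
   (2) => (1). Delta is the projection I - T~_1 T~_1^*, and (a) or (b) makes T~_n
   isometric on X(n) (x) Im Delta, so that W(x (x) d) = T_n(x) d defines an
   isometry W : F_X (x) Im Delta -> H. By
   T~_n T~_n^* - T~_(n+1) T~_(n+1)^* = T~_n (I (x) Delta) T~_n^* and pureness,
   W is onto; the extension is pi(a) = W (a (x) I) W^*. *)

Set Implicit Arguments.
Unset Strict Implicit.
Unset Printing Implicit Defensive.
Import Order.TTheory GRing.Theory Num.Theory.
Import numFieldNormedType.Exports.
Local Open Scope classical_set_scope.
Local Open Scope complex_scope.
Local Open Scope ring_scope.

(** * Scalars and inner products *)

(** Finite dimensionality of E enters through finite frames. Products of frame vectors of X(n) and
    X(m), projected by p_(n+m), again form a frame of X(n+m), although orthonormality does not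
    survive the projection. Hence the projection onto X(0) is a finite combination of products of
    shifts and their adjoints, so it lies in the Toeplitz algebra, and T~_(n+1) T~_(n+1)^* = sum_e
    T_n(e) T~_1 T~_1^* T_n(e)^*, which makes the differences in the converse computable. Partial
    isometries are handled through idempotence of f f^*, a form that passes through a
    representation. That W is isometric rests on <T_n(u) h, T_n(x) Delta k> = <u, x> <h, Delta k>
    for arbitrary h: across different degrees this asymmetry removes the lower degree and leaves an
    operator of positive degree, whose range is orthogonal to Im Delta. The remaining obstacle is
    the bound |a (x) I| <= |a|. It is proved on finite combinations of vectors in the range of W, by
    orthonormalizing the finitely many vectors of Im Delta involved. *)

Section Complex_scalars.
Context {R : realType}.
Implicit Types e x : R[i].

(** In [R[i]] a positive element has zero imaginary part, so the Archimedean property is inherited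
    from [R]. *)
Lemma complex_archi e : 0 < e -> exists k : nat, k.+1%:R^-1 < e.
Proof.
move=> e0; have [a ae] : exists a : R, e = a%:C.
  by exists (complex.Re e); apply/esym/eqP; rewrite eq_complex /= eqxx eq_sym;
     move: e0; rewrite ltcE => /andP[].
have a0 : 0 < a by move: e0; rewrite ae ltcR.
exists (Num.truncn a^-1); rewrite ae.
rewrite -[X in X < _]/(_^-1) invf_plt ?posrE ?ltr0n //; last by rewrite ltcR.
rewrite -fmorphV /= -(rmorph_nat (real_complex R)) ltcR.
by rewrite truncnS_gt.
Qed.

Lemma eq0_small x : (forall e, 0 < e -> `|x| <= e) -> x = 0.
Proof.
move=> h; apply/eqP; apply: contraT => x0.
have x0' : 0 < `|x| by rewrite normr_gt0.
have := h (`|x| / 2) (divr_gt0 x0' (ltr0n _ 2)).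
by rewrite ler_pdivlMr ?ltr0n // mulrDr mulr1 gerDl lt_geF.
Qed.

(** The order of [R[i]] is partial, so the infimum is taken over real parts. The second clause
    provides the minimising sequence in [riesz]. *)
Lemma complex_inf (T : Type) (t0 : T) (q : T -> R[i]) (b : R[i]) :
  (forall t, q t \is Num.real) -> (forall t, b <= q t) ->
  exists m : R[i], (forall t, m <= q t) /\
    forall e, 0 < e -> exists t, q t < m + e.
Proof.
move=> qr bq.
have re (z : R[i]) : z \is Num.real -> z = (complex.Re z)%:C.
  by move=> /Creal_ImP zr; apply/eqP; rewrite eq_complex /= eqxx /=; move: zr;
     case: z => [a c]; rewrite -complexIm /= => -[->].
pose A : set R := [set complex.Re (q t) | t in setT].
have hA : has_inf A.
  split; first by exists (complex.Re (q t0)), t0.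
  exists (complex.Re b) => _ [t _ <-].
  by have := bq t; rewrite lecE => /andP[].
exists (inf A)%:C; split.
  by move=> t; rewrite (re _ (qr t)) lecR; apply: ge_inf; [case: hA|exists t].
move=> e e0; have er : e \is Num.real by apply: gtr0_real.
have [|_ [t _ <-] h] := @inf_adherent _ A (complex.Re e) _ hA.
  by move: e0; rewrite ltcE => /andP[].
by exists t; rewrite (re _ (qr t)) (re _ er) -rmorphD /= ltcR.
Qed.

End Complex_scalars.

Section Linear_maps.
Context {K : numFieldType} {V W : lmodType K} (f : V -> W) (fL : linear f).

Lemma linfun0 : f 0 = 0.
Proof. by have := fL (-1) 0 0; rewrite !scaleN1r oppr0 addr0 addNr. Qed.

Lemma linfunD x y : f (x + y) = f x + f y.
Proof. by have := fL 1 x y; rewrite !scale1r. Qed.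

Lemma linfunZ c x : f (c *: x) = c *: f x.
Proof. by have := fL c x 0; rewrite linfun0 !addr0. Qed.

Lemma linfunN x : f (- x) = - f x.
Proof. by rewrite -scaleN1r linfunZ scaleN1r. Qed.

Lemma linfunB x y : f (x - y) = f x - f y.
Proof. by rewrite linfunD linfunN. Qed.

Lemma linfun_sum I (r : seq I) (P : pred I) (F : I -> V) :
  f (\sum_(i <- r | P i) F i) = \sum_(i <- r | P i) f (F i).
Proof. exact: (big_morph f linfunD linfun0). Qed.

End Linear_maps.

Section Linear_combinations.
Context {K : numFieldType} {U V W : lmodType K}.

Lemma linear_comp (f : V -> W) (g : U -> V) :
  linear f -> linear g -> linear (f \o g).
Proof. by move=> fL gL c x y /=; rewrite gL fL. Qed.

Lemma linear_lincomb (c : K) (f g : V -> W) :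
  linear f -> linear g -> linear (fun x => c *: f x + g x).
Proof.
move=> fL gL a x y; rewrite fL gL !scalerDr !scalerA (mulrC a) -!addrA.
by congr (_ + _); rewrite addrCA.
Qed.

End Linear_combinations.

Section Inner_product.
Context {R : realType} {V : hilbertType R}.
Implicit Types (x y z : V) (c : R[i]).

Lemma innerDr z x y : inner z (x + y) = inner z x + inner z y.
Proof. by have := inner_linearr z 1 x y; rewrite scale1r mul1r. Qed.

Lemma inner0r z : inner z 0 = 0.
Proof. by apply: (addIr (inner z 0)); rewrite -innerDr !add0r. Qed.

Lemma innerZr z c x : inner z (c *: x) = c * inner z x.
Proof. by have := inner_linearr z c x 0; rewrite inner0r !addr0. Qed.

Lemma innerNr z x : inner z (- x) = - inner z x.
Proof. by rewrite -scaleN1r innerZr mulN1r. Qed.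

Lemma innerBr z x y : inner z (x - y) = inner z x - inner z y.
Proof. by rewrite innerDr innerNr. Qed.

Lemma inner_sumr I (r : seq I) z (F : I -> V) :
  inner z (\sum_(i <- r) F i) = \sum_(i <- r) inner z (F i).
Proof. exact: (big_morph _ (innerDr z) (inner0r z)). Qed.

Lemma inner0l z : inner 0 z = 0.
Proof. by rewrite inner_conj inner0r conjC0. Qed.

Lemma innerDl z x y : inner (x + y) z = inner x z + inner y z.
Proof. by rewrite inner_conj innerDr rmorphD /= -!inner_conj. Qed.

Lemma innerZl z c x : inner (c *: x) z = c^*%R * inner x z.
Proof. by rewrite inner_conj innerZr rmorphM /= -inner_conj. Qed.

Lemma innerNl z x : inner (- x) z = - inner x z.
Proof. by rewrite inner_conj innerNr rmorphN /= -inner_conj. Qed.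

Lemma innerBl z x y : inner (x - y) z = inner x z - inner y z.
Proof. by rewrite innerDl innerNl. Qed.

Lemma inner_suml I (r : seq I) z (F : I -> V) :
  inner (\sum_(i <- r) F i) z = \sum_(i <- r) inner (F i) z.
Proof. exact: (big_morph (inner^~ z) (innerDl z) (inner0l z)). Qed.

Lemma inner_self_eq0 x : inner x x = 0 -> x = 0.
Proof. by move/eqP; rewrite inner_norm sqrf_eq0 normr_eq0 => /eqP. Qed.

Lemma inner_inj x y : (forall z, inner z x = inner z y) -> x = y.
Proof.
move=> h; apply/eqP; rewrite -subr_eq0; apply/eqP/inner_self_eq0.
by rewrite innerBr h subrr.
Qed.

Lemma inner_swap_conj x y : (inner x y)^*%R = inner y x.
Proof. by rewrite -inner_conj. Qed.

Lemma cauchy_schwarz x y : `|inner x y| <= `|x| * `|y|.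
Proof.
have [->|y0] := eqVneq y 0; first by rewrite inner0r !normr0 mulr0.
have y0' : 0 < `|y| by rewrite normr_gt0.
have y2 : 0 < `|y| ^+ 2 by rewrite exprn_gt0.
rewrite -(@ler_pXn2r _ 2) ?nnegrE ?mulr_ge0 // exprMn -ler_pdivrMr //.
(* [c *: y] is the orthogonal projection of x onto the line through y; the inequality is positivity
   of the squared norm of x - c y. *)
set c := inner y x / `|y| ^+ 2.
have : 0 <= inner (x - c *: y) (x - c *: y) by rewrite inner_norm exprn_ge0.
rewrite innerBl !innerBr !innerZl !innerZr !inner_norm.
have -> : c^*%R = inner x y / `|y| ^+ 2.
  by rewrite rmorphM /= inner_swap_conj geC0_conj // invr_ge0 ltW.
rewrite /c [inner y x]inner_conj normCK -[(_ / _ <= _)]subr_ge0; move: (inner x y) => a.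
congr (0 <= _); field; exact: lt0r_neq0.
Qed.

Lemma pythagoras x y : inner x y = 0 -> `|x + y| ^+ 2 = `|x| ^+ 2 + `|y| ^+ 2.
Proof.
move=> xy; rewrite -!inner_norm innerDl !innerDr xy [inner y x]inner_conj xy.
by rewrite conjC0 add0r addr0.
Qed.

End Inner_product.

Section Polarization.
Context {R : realType} {V : hilbertType R}.

(** Expanding B at x + z gives B(x, z) = - B(z, x). The choice z = i y turns this into B(x, y) =
    B(y, x) because B is conjugate linear on the left, so 2 B(x, y) = 0. *)
Lemma polarization (B : V -> V -> R[i]) :
  (forall x y z, B (x + y) z = B x z + B y z) ->
  (forall x y z, B z (x + y) = B z x + B z y) ->
  (forall c x y, B (c *: x) y = c^*%R * B x y) ->
  (forall c x y, B x (c *: y) = c * B x y) ->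
  (forall x, B x x = 0) -> forall x y, B x y = 0.
Proof.
move=> Dl Dr Zl Zr B0 x y.
have h z : B x z + B z x = 0.
  by have := B0 (x + z); rewrite Dl !Dr !B0 add0r addr0.
have := h ('i%R *: y); rewrite Zl Zr conjCi mulNr -mulrBr => /eqP.
rewrite mulf_eq0 (negbTE (neq0Ci _)) subr_eq0 => /eqP e.
have /eqP := h y; rewrite -e -mulr2n -mulr_natl mulf_eq0 pnatr_eq0 /=.
by move=> /eqP.
Qed.

End Polarization.

(** * Bounded operators and adjoints *)

Section Topology.
Context {R : realType}.
Implicit Types V W U : hilbertType R.

Lemma bounded_opP V W (f : V -> W) : bounded_op f <->
  linear f /\ exists2 M : R[i], 0 <= M & forall x, `|f x| <= M * `|x|.
Proof.
split=> -[fL fC]; split=> //.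
  pose F : {linear V -> W} := HB.pack f (GRing.isLinear.Build _ _ _ _ f fL).
  have /linear_bounded_continuous/linear_boundedP : continuous F by exact: fC.
  by move=> /pinfty_ex_gt0[M M0 h]; exists M; first exact: ltW.
case: fC => M M0 fM x; apply/cvgrPdist_le => e e0.
(* The bound M may be 0, hence the denominator M + 1. *)
apply/nbhs_normP; exists (e / (M + 1)) => /=.
  by rewrite divr_gt0 // ltr_pwDr.
move=> y /= xy; rewrite -linfunB //; apply: (le_trans (fM _)).
have M1 : 0 < M + 1 by rewrite ltr_pwDr.
apply: (@le_trans _ _ ((M + 1) * `|x - y|)).
  by rewrite ler_wpM2r // lerDl.
by rewrite mulrC -ler_pdivlMr // ltW.
Qed.

Lemma bounded_op_linear V W (f : V -> W) : bounded_op f -> linear f.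
Proof. by case. Qed.

Lemma closedP V (S : set V) : closed S <->
  forall x, (forall e : R[i], 0 < e -> exists2 y, S y & `|x - y| < e) -> S x.
Proof.
split=> [Sc x h|h].
  rewrite (closure_id S).1 // => B /nbhs_normP[e /= e0 eB].
  by have [y Sy xy] := h e e0; exists y; split=> //; exact: eB.
move=> x xS; apply: h => e e0.
have /xS[y [Sy xy]] : nbhs x [set y | `|x - y| < e].
  by apply/nbhs_normP; exists e.
by exists y.
Qed.

Lemma closed_span_subspace V (A : set V) : closed_subspace (closed_span A).
Proof.
split.
- by move=> S [[S0 _ _] _].
- move=> c x y Ax Ay S SA; have [[_ SL _] _] := SA.
  by apply: SL; [exact: Ax|exact: Ay].
- apply/closedP => x h S SA; have [[_ _ /closedP SC] _] := SA.
  by apply: SC => e /h[y Ay ?]; exists y => //; exact: Ay.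
Qed.

Lemma closed_span_min V (A S : set V) :
  closed_subspace S -> A `<=` S -> closed_span A `<=` S.
Proof. by move=> SS AS x; apply. Qed.

Lemma sub_closed_span V (A : set V) : A `<=` closed_span A.
Proof. by move=> x Ax S [_ AS]; exact: AS. Qed.

Lemma closed_span_total V (A S : set V) : closed_span A = setT ->
  closed_subspace S -> A `<=` S -> forall x, S x.
Proof.
by move=> AT SS AS x; apply: (closed_span_min SS AS); rewrite AT.
Qed.

Lemma closed_subspace_sum V (S : set V) I (r : seq I) (F : I -> V) :
  closed_subspace S -> (forall i, S (F i)) -> S (\sum_(i <- r) F i).
Proof.
case=> S0 SL _ SF; elim/big_ind: _ => // x y Sx Sy.
by rewrite -[x]scale1r; apply: SL.
Qed.

Lemma closed_subspaceD V (S : set V) x y :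
  closed_subspace S -> S x -> S y -> S (x + y).
Proof. by case=> S0 SL _ Sx Sy; rewrite -[x]scale1r; apply: SL. Qed.

Lemma closed_subspace_ker V W (f : V -> W) :
  bounded_op f -> closed_subspace [set x | f x = 0].
Proof.
move=> /bounded_opP[fL [M M0 fM]]; split=> /=.
- exact: linfun0.
- by move=> c x y fx fy; rewrite fL fx fy scaler0 addr0.
- apply/closedP => x h /=; apply/normr0_eq0/eq0_small => e e0.
  have M1 : 0 < M + 1 by rewrite ltr_pwDr.
  have [y fy xy] := h (e / (M + 1)) (divr_gt0 e0 M1).
  rewrite normr_id -[f x]subr0 -fy -linfunB //; apply: (le_trans (fM _)).
  apply: (@le_trans _ _ ((M + 1) * `|x - y|)).
    by rewrite ler_wpM2r // lerDl.
  by rewrite mulrC -ler_pdivlMr // ltW.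
Qed.

Lemma bounded_op_lincomb V W (c : R[i]) (f g : V -> W) :
  bounded_op f -> bounded_op g -> bounded_op (fun x => c *: f x + g x).
Proof.
move=> /bounded_opP[fL [M M0 fM]] /bounded_opP[gL [N N0 gN]].
apply/bounded_opP; split; first exact: linear_lincomb.
exists (`|c| * M + N) => [|x]; first by rewrite addr_ge0 ?mulr_ge0.
rewrite (le_trans (ler_normD _ _)) // mulrDl lerD // normrZ -mulrA.
by rewrite ler_wpM2l.
Qed.

Lemma bounded_op_comp U V W (f : V -> W) (g : U -> V) :
  bounded_op f -> bounded_op g -> bounded_op (f \o g).
Proof.
move=> /bounded_opP[fL [M M0 fM]] /bounded_opP[gL [N N0 gN]].
apply/bounded_opP; split; first exact: linear_comp.
exists (M * N) => [|x]; first by rewrite mulr_ge0.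
by rewrite (le_trans (fM _)) // -mulrA ler_wpM2l.
Qed.

Lemma bounded_op0 V W : bounded_op (fun _ : V => 0 : W).
Proof.
apply/bounded_opP; split=> [c x y|]; first by rewrite scaler0 addr0.
by exists 0 => // x; rewrite normr0 mul0r.
Qed.

Lemma bounded_op_id V : bounded_op (@idfun V).
Proof. by apply/bounded_opP; split=> //; exists 1 => // x; rewrite mul1r. Qed.

Lemma bounded_opZ V W (c : R[i]) (f : V -> W) :
  bounded_op f -> bounded_op (fun x => c *: f x).
Proof.
move=> fb; have := bounded_op_lincomb c fb (bounded_op0 V W).
by under eq_fun do rewrite addr0.
Qed.

Lemma bounded_opD V W (f g : V -> W) :
  bounded_op f -> bounded_op g -> bounded_op (fun x => f x + g x).
Proof.
move=> fb gb; have := bounded_op_lincomb 1 fb gb.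
by under eq_fun do rewrite scale1r.
Qed.

Lemma bounded_opB V W (f g : V -> W) :
  bounded_op f -> bounded_op g -> bounded_op (fun x => f x - g x).
Proof.
move=> fb gb; have := bounded_opD fb (bounded_opZ (-1) gb).
by under eq_fun do rewrite scaleN1r.
Qed.

Lemma bounded_op_sum V W I (r : seq I) (f : I -> V -> W) :
  (forall i, bounded_op (f i)) -> bounded_op (fun x => \sum_(i <- r) f i x).
Proof.
move=> fb; elim: r => [|i r IH].
  by under eq_fun do rewrite big_nil; exact: bounded_op0.
by under eq_fun do rewrite big_cons; exact: bounded_opD.
Qed.

Lemma bounded_op_eq V W (A : set V) (f g : V -> W) : closed_span A = setT ->
  bounded_op f -> bounded_op g -> (forall x, A x -> f x = g x) -> f = g.
Proof.
move=> AT fb gb fg; apply/funext => x; apply/eqP; rewrite -subr_eq0; apply/eqP.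
move: x; apply: (closed_span_total AT (closed_subspace_ker (bounded_opB fb gb))).
by move=> x Ax /=; rewrite fg // subrr.
Qed.

Lemma closed_subspace_orth V W (f : V -> W) z :
  bounded_op f -> closed_subspace [set x | inner z (f x) = 0].
Proof.
move=> /bounded_opP[fL [M M0 fM]]; split=> /=.
- by rewrite linfun0 // inner0r.
- by move=> c x y fx fy; rewrite fL innerDr innerZr fx fy mulr0 addr0.
- apply/closedP => x h /=; apply/eq0_small => e e0.
  have M1 : 0 < `|z| * M + 1 by rewrite ltr_pwDr // mulr_ge0.
  have [y fy xy] := h (e / (`|z| * M + 1)) (divr_gt0 e0 M1).
  rewrite -[inner _ _]subr0 -fy -innerBr -linfunB //.
  apply: (le_trans (cauchy_schwarz _ _)).
  apply: (@le_trans _ _ ((`|z| * M + 1) * `|x - y|)).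
    rewrite mulrDl -mulrA (@le_trans _ _ (`|z| * (M * `|x - y|))) //.
      by rewrite ler_wpM2l.
    by rewrite lerDl mulr_ge0.
  by rewrite mulrC -ler_pdivlMr // ltW.
Qed.

Lemma cauchy_converges V (u : nat -> V) :
  (forall e : R[i], 0 < e -> exists N : nat, forall i j, (N <= i)%N -> (N <= j)%N ->
     `|u i - u j| <= e) ->
  exists l, forall e : R[i], 0 < e -> exists N : nat, forall i, (N <= i)%N ->
     `|l - u i| <= e.
Proof.
move=> h.
have uc : cauchy (u @ \oo).
  apply/cauchy_exP => e e0; have [N hN] := h (e / 2) (divr_gt0 e0 (ltr0n _ 2)).
  exists (u N); exists N => //= i /= Ni; rewrite -ball_normE /=.
  apply: (le_lt_trans (hN _ _ _ Ni)) => //.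
  by rewrite ltr_pdivrMr ?ltr0n // mulr_natr mulr2n ltrDl.
have /cvgrPdist_le ul : u @ \oo --> lim (u @ \oo) by exact: cauchy_cvg.
exists (lim (u @ \oo)) => e /ul[N _ hN]; exists N => i Ni; exact: hN.
Qed.

End Topology.

Section Adjoints.
Context {R : realType}.
Implicit Types V W U : hilbertType R.

(* A minimising sequence of |x|^2 - 2 Re (f x) is Cauchy by the parallelogram
   identity, and its limit represents f. *)
Lemma riesz V (f : V -> R[i]) (M : R[i]) : scalar f -> 0 <= M ->
  (forall x, `|f x| <= M * `|x|) -> exists z, forall x, f x = inner z x.
Proof.
move=> fL M0 fM.
have f0 : f 0 = 0 by have := fL (-1) 0 0; rewrite scaler0 add0r mulN1r addNr.
have fD x y : f (x + y) = f x + f y by rewrite -[x]scale1r fL mul1r scale1r.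
have fZ c x : f (c *: x) = c * f x by rewrite -[c *: x]addr0 fL f0 addr0.
pose q x := inner x x - f x - (f x)^*%R.
have qr x : q x \is Num.real.
  apply/CrealP; rewrite /q !rmorphB /= conjCK inner_swap_conj.
  by rewrite -!addrA; congr (_ + _); rewrite addrC.
(* Completing the square: q x + M^2 is at least (|x| - M)^2. *)
have qb x : - M ^+ 2 <= q x.
  have h : `|f x + (f x)^*%R| <= 2 * M * `|x|.
    rewrite (le_trans (ler_normD _ _)) // norm_conjC.
    have -> : `|f x| + `|f x| = 2 * `|f x| by ring.
    by rewrite -mulrA ler_wpM2l ?ler0n.
  have r : f x + (f x)^*%R \is Num.real.
    by apply/CrealP; rewrite rmorphD /= conjCK addrC.
  rewrite /q -addrA -opprD lerBrDl -lerBrDr opprK.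
  apply: (le_trans (real_ler_norm r)); apply: (le_trans h).
  rewrite inner_norm -subr_ge0.
  have -> : `|x| ^+ 2 + M ^+ 2 - 2 * M * `|x| = (`|x| - M) ^+ 2 by ring.
  by rewrite real_exprn_even_ge0 // realB // ger0_real.
have [m [mq mx]] := complex_inf 0 qr qb.
have par x y : `|x - y| ^+ 2 <= 2 * (q x - m) + 2 * (q y - m).
  rewrite -subr_ge0.
  have -> : 2 * (q x - m) + 2 * (q y - m) - `|x - y| ^+ 2 =
            4 * (q (2^-1 *: (x + y)) - m).
    rewrite /q -!inner_norm fZ fD innerBl !innerBr innerZl innerZr innerDl !innerDr.
    rewrite !rmorphM !rmorphD /=.
    have -> : (2^-1)^*%R = 2^-1 :> R[i] by rewrite geC0_conj // invr_ge0 ler0n.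
    by field.
  by rewrite mulr_ge0 ?ler0n // subr_ge0.
pose eps k : R[i] := k.+1%:R^-1.
have eps0 k : 0 < eps k by rewrite invr_gt0 ltr0n.
have epsm k l : (k <= l)%N -> eps l <= eps k.
  by move=> kl; rewrite lef_pV2 ?posrE ?ltr0n // ler_nat.
have /(_ _)/cid-/all_sig[u uP] k := mx (eps k) (eps0 k).
have um k : q (u k) - m <= eps k by rewrite lerBlDl ltW.
have [z uz] : exists l, forall e : R[i], 0 < e ->
    exists N : nat, forall i, (N <= i)%N -> `|l - u i| <= e.
  apply: cauchy_converges => e e0.
  have [N hN] := complex_archi (divr_gt0 (exprn_gt0 2 e0) (ltr0n _ 4)).
  exists N => i j Ni Nj; rewrite -(@ler_pXn2r _ 2) ?nnegrE ?(ltW e0) //.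
  apply: (le_trans (par _ _)); rewrite -mulrDr.
  apply: (@le_trans _ _ (2 * (eps N + eps N))).
    rewrite ler_wpM2l ?ler0n // lerD //.
      exact: (le_trans (um i) (epsm _ _ Ni)).
    exact: (le_trans (um j) (epsm _ _ Nj)).
  have -> : 2 * (eps N + eps N) = eps N * 4 by ring.
  by rewrite -ler_pdivlMr ?ltr0n // ltW.
exists z => y; apply/esym/eqP; rewrite -subr_eq0; apply/eqP.
(* First variation: moving from [u k] by - s g^* y with s = 1 / (|y|^2 + 1) lowers q by at least s
   |g|^2, while q stays above m and [q (u k)] is at most m + [eps k]. *)
have gk k : `|inner (u k) y - f y| ^+ 2 <= eps k * (`|y| ^+ 2 + 1).
  set g := inner (u k) y - f y; set s : R[i] := (`|y| ^+ 2 + 1)^-1.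
  have s0 : 0 < `|y| ^+ 2 + 1 by rewrite ltr_pwDr // exprn_ge0.
  have s0' : 0 <= s by rewrite invr_ge0 ltW.
  have : m <= q (u k + (- s * g^*%R) *: y) by [].
  have -> : q (u k + (- s * g^*%R) *: y) =
      q (u k) + s ^+ 2 * (`|g| ^+ 2) * `|y| ^+ 2 - 2 * s * `|g| ^+ 2.
    have tc : (- s * g^*%R)^*%R = - s * g.
      by rewrite rmorphM /= rmorphN /= conjCK geC0_conj.
    rewrite /q fD fZ normCK innerDl !innerDr !innerZl !innerZr tc.
    have -> : (f (u k) + - s * g^*%R * f y)^*%R = (f (u k))^*%R + - s * g * (f y)^*%R.
      by rewrite -tc -rmorphM -rmorphD.
    rewrite inner_norm [inner y (u k)]inner_conj.
    have -> : inner (u k) y = g + f y by rewrite /g subrK.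
    by clearbody g; rewrite rmorphD inner_norm; ring.
  rewrite -subr_ge0 => h.
  rewrite -ler_pdivrMr // -/s.
  have : 0 <= eps k + s ^+ 2 * `|g| ^+ 2 * `|y| ^+ 2 - 2 * s * `|g| ^+ 2.
    apply: (le_trans h); rewrite -subr_ge0.
    have -> : forall a b c d : R[i], a + b - c - (d + b - c - m) = a - (d - m).
      by move=> *; ring.
    by rewrite subr_ge0.
  have -> : s ^+ 2 * `|g| ^+ 2 * `|y| ^+ 2 = s * `|g| ^+ 2 - s ^+ 2 * `|g| ^+ 2.
    rewrite /s; field; exact: lt0r_neq0.
  move=> h2; rewrite -subr_ge0; apply: (le_trans h2).
  rewrite -subr_ge0.
  have -> : eps k - `|g| ^+ 2 * s - (eps k + (s * `|g| ^+ 2 - s ^+ 2 * `|g| ^+ 2) -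
    2 * s * `|g| ^+ 2) = s ^+ 2 * `|g| ^+ 2 by ring.
  by rewrite mulr_ge0 ?exprn_ge0.
apply: eq0_small => e e0.
have c0 : 0 < `|y| ^+ 2 + 1 by rewrite ltr_pwDr // exprn_ge0.
have e2 : 0 < e / 2 by rewrite divr_gt0 ?ltr0n.
have [N1 h1] := complex_archi (divr_gt0 (exprn_gt0 2 e2) c0).
have y1 : 0 < `|y| + 1 by rewrite ltr_pwDr.
have [N2 h2] := uz _ (divr_gt0 e2 y1).
pose k := maxn N1 N2.
have -> : inner z y - f y = inner (z - u k) y + (inner (u k) y - f y).
  by rewrite innerBl addrA subrK.
rewrite (le_trans (ler_normD _ _)) //.
have -> : e = e / 2 + e / 2 by field.
apply: lerD.
  apply: (le_trans (cauchy_schwarz _ _)).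
  apply: (@le_trans _ _ (e / 2 / (`|y| + 1) * (`|y| + 1))).
    by rewrite ler_pM // ?lerDl // h2 // leq_maxr.
  by rewrite divfK // lt0r_neq0.
rewrite -(@ler_pXn2r _ 2) ?nnegrE // ?(ltW e2) //.
apply: (le_trans (gk k)); rewrite -ler_pdivlMr //.
exact: (le_trans (epsm _ _ (leq_maxl N1 N2)) (ltW h1)).
Qed.

(** Riesz representation of x |-> <y, f x>, one y at a time, produces an adjoint, so [adj] does not
    take its default value here. *)
Lemma inner_adj V W (f : V -> W) : bounded_op f ->
  forall x y, inner (f x) y = inner x (adj f y).
Proof.
move=> /bounded_opP[fL [M M0 fM]].
have ex y : exists z, forall x, inner y (f x) = inner z x.
  apply: (@riesz _ _ (`|y| * M)).
  - by move=> c x x'; rewrite fL innerDr innerZr.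
  - by rewrite mulr_ge0.
  - move=> x; apply: (le_trans (cauchy_schwarz _ _)).
    by rewrite -mulrA ler_wpM2l.
have /(_ _)/cid-/all_sig[g gP] := ex.
apply: (@xgetPex _ (fun=> 0) [set g : W -> V |
  forall x y, inner (f x) y = inner x (g y)]).
by exists g => x y; rewrite inner_conj gP -inner_conj.
Qed.

Lemma adj_unique V W (f : V -> W) (g : W -> V) :
  (forall x y, inner (f x) y = inner x (g y)) -> adj f = g.
Proof.
move=> h; apply/funext => y; apply: inner_inj => x.
rewrite -h; apply/esym; move: x y.
apply: (@xgetPex _ (fun=> 0) [set g : W -> V |
  forall x y, inner (f x) y = inner x (g y)]).
by exists g.
Qed.

Lemma adj_inner V W (f : V -> W) : bounded_op f ->
  forall x y, inner (adj f x) y = inner x (f y).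
Proof. by move=> fb x y; rewrite inner_conj -inner_adj // -inner_conj. Qed.

Lemma bounded_adj V W (f : V -> W) : bounded_op f -> bounded_op (adj f).
Proof.
move=> fb; have /bounded_opP[fL [M M0 fM]] := fb.
apply/bounded_opP; split.
  move=> c x y; apply: inner_inj => z.
  by rewrite -inner_adj // !innerDr !innerZr -!inner_adj.
exists M => // y; have [->|n0] := eqVneq (adj f y) 0.
  by rewrite normr0 mulr_ge0.
have n0' : 0 < `|adj f y| by rewrite normr_gt0.
rewrite -(ler_pM2r n0') -expr2 -inner_norm -inner_adj //.
rewrite -[inner _ _]ger0_norm; last by rewrite inner_adj // inner_norm exprn_ge0.
apply: (le_trans (cauchy_schwarz _ _)).
by rewrite mulrAC ler_wpM2r.
Qed.

Lemma adj_comp U V W (f : V -> W) (g : U -> V) :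
  bounded_op f -> bounded_op g -> adj (f \o g) = adj g \o adj f.
Proof. by move=> fb gb; apply: adj_unique => x y /=; rewrite !inner_adj. Qed.

End Adjoints.

(** * Bounded maps prescribed on a total family *)

Section Bounded_extension.
Context {R : realType}.

Lemma real_le_small (a b C : R[i]) : a \is Num.real -> b \is Num.real ->
  0 <= C -> (forall e, 0 < e -> a <= b + C * e) -> a <= b.
Proof.
move=> ar br C0 h; rewrite real_leNgt //; apply/negP => ba.
have C1 : 0 < C + 1 by rewrite ltr_pwDr.
have e0 : 0 < (a - b) / (C + 1) by rewrite divr_gt0 ?subr_gt0.
have := h _ e0; rewrite -lerBlDl mulrCA ler_pMr ?subr_gt0 //.
by rewrite ler_pdivlMr // mul1r lt_geF // ltrDl.
Qed.

Context {V W : hilbertType R} {I : Type}.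
Implicit Type s : seq (R[i] * I).

(** The coefficients and indices form a list independent of the vectors, so that one list can be
    evaluated in V and in W at once, and concatenation acts as addition even when the vectors are
    dependent. *)
Definition lincomb {U : hilbertType R} (u : I -> U) s := \sum_(p <- s) p.1 *: u p.2.

Definition scale_lincomb c s := [seq (c * p.1, p.2) | p <- s].

Lemma lincombZD (U : hilbertType R) (u : I -> U) c s s' :
  lincomb u (scale_lincomb c s ++ s') = c *: lincomb u s + lincomb u s'.
Proof.
rewrite /lincomb big_cat big_map scaler_sumr; congr (_ + _).
by apply: eq_bigr => p _; rewrite scalerA.
Qed.

Lemma lincomb_cons (U : hilbertType R) (u : I -> U) p s :
  lincomb u (p :: s) = p.1 *: u p.2 + lincomb u s.
Proof. by rewrite /lincomb big_cons. Qed.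

Lemma lincomb_dense (U : hilbertType R) (u : I -> U) :
  closed_span [set x | exists i, x = u i] = setT ->
  forall x e, 0 < e -> exists s, `|x - lincomb u s| <= e.
Proof.
move=> uT x; move: x; apply: (closed_span_total uT); last first.
  move=> _ [i ->] /= e e0; exists [:: (1, i)].
  by rewrite /lincomb big_seq1 /= scale1r subrr normr0 ltW.
split=> /=.
- by move=> e e0; exists [::]; rewrite /lincomb big_nil subrr normr0 ltW.
- move=> c x y hx hy e e0.
  have c1 : 0 < `|c| + 1 by rewrite ltr_pwDr.
  have [s hs] := hx (e / 2 / (`|c| + 1)) (divr_gt0 (divr_gt0 e0 (ltr0n _ 2)) c1).
  have [s' hs'] := hy (e / 2) (divr_gt0 e0 (ltr0n _ 2)).
  exists (scale_lincomb c s ++ s'); rewrite lincombZD opprD addrACA -scalerBr.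
  rewrite (le_trans (ler_normD _ _)) // normrZ [e]splitr lerD //.
  apply: (@le_trans _ _ ((`|c| + 1) * (e / 2 / (`|c| + 1)))).
    by rewrite ler_pM // lerDl.
  by rewrite mulrC divfK // lt0r_neq0.
- apply/closedP => x h e e0.
  have e2 : 0 < e / 2 by rewrite divr_gt0 ?ltr0n.
  have [y hy xy] := h _ e2; have [s hs] := hy _ e2.
  exists s; rewrite -(subrK y x) -addrA (le_trans (ler_normD _ _)) //.
  by rewrite [e]splitr lerD // ltW.
Qed.

(** The relation [Gr] is the closure of the graph of the combinations. The bound C passes to [Gr]
    and makes it single valued, also when the [v i] are dependent; density of the span and
    completeness of W make it total. *)
Lemma bounded_extension (v : I -> V) (w : I -> W) (C : R[i]) : 0 <= C ->
  closed_span [set x | exists i, x = v i] = setT ->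
  (forall s, `|lincomb w s| <= C * `|lincomb v s|) ->
  exists S : V -> W, bounded_op S /\ forall i, S (v i) = w i.
Proof.
move=> C0 vT hC.
pose Gr x y := forall e, 0 < e ->
  exists s, `|x - lincomb v s| <= e /\ `|y - lincomb w s| <= e.
have GrL c x y x' y' : Gr x y -> Gr x' y' -> Gr (c *: x + x') (c *: y + y').
  move=> h h' e e0.
  have c1 : 0 < `|c| + 1 by rewrite ltr_pwDr.
  have [s [sx sy]] := h (e / 2 / (`|c| + 1)) (divr_gt0 (divr_gt0 e0 (ltr0n _ 2)) c1).
  have [s' [sx' sy']] := h' (e / 2) (divr_gt0 e0 (ltr0n _ 2)).
  have aux (U : hilbertType R) (a b a' b' : U) :
      `|a - a'| <= e / 2 / (`|c| + 1) -> `|b - b'| <= e / 2 ->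
      `|c *: a + b - (c *: a' + b')| <= e.
    move=> ha hb; rewrite opprD addrACA -scalerBr.
    rewrite (le_trans (ler_normD _ _)) // normrZ [e]splitr lerD //.
    apply: (@le_trans _ _ ((`|c| + 1) * (e / 2 / (`|c| + 1)))).
      by rewrite ler_pM // lerDl.
    by rewrite mulrC divfK // lt0r_neq0.
  by exists (scale_lincomb c s ++ s'); rewrite !lincombZD; split; exact: aux.
have Grb x y : Gr x y -> `|y| <= C * `|x|.
  move=> h; apply: (@real_le_small _ _ (1 + C)); rewrite ?ger0_real ?mulr_ge0 //.
    by rewrite addr_ge0.
  move=> e e0; have [s [sx sy]] := h e e0.
  rewrite -(subrK (lincomb w s) y) (le_trans (ler_normD _ _)) //.
  rewrite mulrDl mul1r addrCA lerD // -mulrDr.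
  apply: (le_trans (hC s)); rewrite ler_wpM2l //.
  have -> : lincomb v s = x - (x - lincomb v s) by rewrite subKr.
  by rewrite (le_trans (ler_normB _ _)) // lerD.
have GrT x : exists y, Gr x y.
  pose eps k : R[i] := k.+1%:R^-1.
  have eps0 k : 0 < eps k by rewrite invr_gt0 ltr0n.
  have epsm k l : (k <= l)%N -> eps l <= eps k.
    by move=> kl; rewrite lef_pV2 ?posrE ?ltr0n // ler_nat.
  have /(_ _)/cid-/all_sig[u uP] k := lincomb_dense vT x (eps0 k).
  have [y hy] : exists l, forall e : R[i], 0 < e -> exists N : nat,
      forall i, (N <= i)%N -> `|l - lincomb w (u i)| <= e.
    apply: cauchy_converges => e e0.
    have C1 : 0 < (C + 1) * 2 by rewrite mulr_gt0 ?ltr0n // ltr_pwDr.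
    have [N hN] := complex_archi (divr_gt0 e0 C1).
    exists N => i j Ni Nj.
    have -> : lincomb w (u i) - lincomb w (u j) =
              lincomb w (scale_lincomb (-1) (u j) ++ u i).
      by rewrite lincombZD scaleN1r addrC.
    apply: (le_trans (hC _)); rewrite lincombZD scaleN1r.
    apply: (@le_trans _ _ ((C + 1) * (eps N + eps N))).
      rewrite ler_pM // ?lerDl //.
      have -> : - lincomb v (u j) + lincomb v (u i) =
                (x - lincomb v (u j)) - (x - lincomb v (u i)).
        by rewrite opprB [RHS]addrC addrA subrK addrC.
      rewrite (le_trans (ler_normB _ _)) // lerD //.
        by rewrite (le_trans (uP j)) ?epsm.
      by rewrite (le_trans (uP i)) ?epsm.
    have -> : (C + 1) * (eps N + eps N) = eps N * ((C + 1) * 2) by ring.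
    by rewrite -ler_pdivlMr // ltW.
  exists y => e e0; have [N1 h1] := hy e e0; have [N2 h2] := complex_archi e0.
  exists (u (maxn N1 N2)); split; last by rewrite h1 // leq_maxl.
  by rewrite (le_trans (uP _)) // (le_trans _ (ltW h2)) // epsm // leq_maxr.
have /(_ _)/cid-/all_sig[S SP] := GrT.
have Gru x y : Gr x y -> S x = y.
  move=> h; have := Grb _ _ (GrL (-1) _ _ _ _ h (SP x)).
  rewrite !scaleN1r addNr normr0 mulr0 normr_le0 addrC subr_eq0.
  by move/eqP.
exists S; split; last first.
  move=> i; apply: Gru => e e0; exists [:: (1, i)].
  by rewrite /lincomb !big_seq1 /= !scale1r !subrr !normr0; split; exact: ltW.
apply/bounded_opP; split; last by exists C => // x; exact: Grb.
by move=> c x y; apply: Gru; exact: GrL.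
Qed.

End Bounded_extension.

(** * Frames and partial isometries *)

Section Frames.
Context {R : realType}.
Implicit Types V W : hilbertType R.

Definition frame_op V (u : seq V) (x : V) := \sum_(e <- u) inner e x *: e.

(* A finite Parseval frame. Unlike orthonormal bases, frames are carried to a
   subspace by the adjoint of its inclusion ([frame_isometric]). *)
Definition frame V (u : seq V) := forall x, frame_op u x = x.

Lemma bounded_inner V (e f : V) : bounded_op (fun x => inner e x *: f).
Proof.
apply/bounded_opP; split=> [c x y|].
  by rewrite innerDr innerZr scalerDl scalerA.
exists (`|e| * `|f|) => [|x]; first by rewrite mulr_ge0.
by rewrite normrZ mulrAC ler_wpM2r // cauchy_schwarz.
Qed.

Lemma bounded_frame_op V (u : seq V) : bounded_op (frame_op u).
Proof. exact: (bounded_op_sum u (fun e => bounded_inner e e)). Qed.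

Lemma frame_op_linear V (u : seq V) : linear (frame_op u).
Proof. exact/bounded_op_linear/bounded_frame_op. Qed.

Lemma inner_frame_op V (u : seq V) x y :
  inner (frame_op u x) y = \sum_(e <- u) inner x e * inner e y.
Proof.
by rewrite inner_suml; apply: eq_bigr => e _; rewrite innerZl inner_swap_conj.
Qed.

(** The induction also carries that [frame_op u] fixes the members of u. This replaces
    orthonormality: it makes [frame_op u] idempotent, hence the projection onto the span of u. *)
Lemma gram_schmidt V (s : seq V) : exists u : seq V,
  forall x, x \in s -> frame_op u x = x.
Proof.
suff [u [_ uP]] : exists u : seq V, (forall e, e \in u -> frame_op u e = e) /\
    forall x, x \in s -> frame_op u x = x by exists u.
elim: s => [|d s [u [uu us]]]; first by exists [::]; split.
pose r := d - frame_op u d.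
have [r0|r0] := eqVneq r 0.
  exists u; split=> // x; rewrite inE => /orP[/eqP->|/us//].
  by apply/esym/eqP; rewrite -subr_eq0; apply/eqP.
have idem x : frame_op u (frame_op u x) = frame_op u x.
  rewrite [X in frame_op u X]/frame_op (linfun_sum (frame_op_linear u)).
  rewrite big_seq [RHS]big_seq; apply: eq_bigr => e eu.
  by rewrite (linfunZ (frame_op_linear u)) uu.
have ur e : e \in u -> inner e r = 0.
  (* The residual r is killed by the idempotent [frame_op u], so the nonnegative terms |<e, r>|^2
     sum to 0. *)
  have /eqP : \sum_(e <- u) inner r e * inner e r = 0.
    by rewrite -inner_frame_op /r (linfunB (frame_op_linear u)) idem subrr inner0l.
  rewrite psumr_eq0 => [/allP h eu|i _]; last first.
    by rewrite [inner r i]inner_conj -normCKC exprn_ge0.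
  by have := h e eu; rewrite /= [inner r e]inner_conj mulf_eq0 conjC_eq0 orbb => /eqP.
pose v := `|r|^-1 *: r.
have vv : inner v v = 1.
  rewrite inner_norm normrZ normfV normr_id mulVf ?expr1n //.
  by rewrite normr_eq0.
have uv e : e \in u -> inner e v = 0.
  by move=> eu; rewrite innerZr ur // mulr0.
have vu e : e \in u -> inner v e = 0.
  by move=> eu; rewrite inner_conj uv // conjC0.
have vx x : frame_op u x = x -> inner v x = 0.
  move=> <-; rewrite inner_sumr big1_seq // => e /andP[_ eu].
  by rewrite innerZr vu // mulr0.
have uv0 : frame_op u v = 0.
  by rewrite /frame_op big1_seq // => e /andP[_ eu]; rewrite uv // scale0r.
have vE x : frame_op (v :: u) x = inner v x *: v + frame_op u x.
  by rewrite /frame_op big_cons.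
exists (v :: u); split=> x; rewrite inE => /orP[/eqP->|xs].
- by rewrite vE uv0 vv scale1r addr0.
- by rewrite vE uu // vx ?uu // scale0r add0r.
- have rd : r = `|r| *: v by rewrite scalerA divff ?normr_eq0 // scale1r.
  have -> : d = r + frame_op u d by rewrite subrK.
  rewrite (linfunD (frame_op_linear _)) !vE idem (vx (frame_op u d)) ?idem // scale0r add0r.
  by rewrite rd innerZr (linfunZ (frame_op_linear u)) uv0 scaler0 vv mulr1 addr0.
- by rewrite vE us // vx ?us // scale0r add0r.
Qed.

(* Used with [g] and [a \o g] to bound the ampliation of [a] by the norm of [a]. *)
Lemma gram_sum V W (T : eqType) (s : seq T) (u : seq V) (d : T -> V) (g : T -> W) :
  (forall p, p \in s -> frame_op u (d p) = d p) ->
  \sum_(p <- s) \sum_(q <- s) inner (d p) (d q) * inner (g p) (g q) =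
  \sum_(e <- u) `|\sum_(p <- s) inner e (d p) *: g p| ^+ 2.
Proof.
move=> du.
under [RHS]eq_bigr => e _.
  rewrite -inner_norm inner_suml.
  under eq_bigr => p _ do rewrite inner_sumr.
  over.
rewrite [RHS]exchange_big /= [LHS]big_seq [RHS]big_seq.
apply: eq_bigr => p ps; rewrite [RHS]exchange_big /=; apply: eq_bigr => q _.
rewrite -[d p in LHS]du // inner_frame_op mulr_suml; apply: eq_bigr => e _.
by rewrite innerZl innerZr inner_swap_conj; ring.
Qed.

End Frames.

Section Partial_isometries.
Context {R : realType}.
Implicit Types V W : hilbertType R.

(** With z = f f^* h - h one has |f^* z|^2 = <z, f f^* z> = 0, so f^* f f^* = f^*; the claim is the
    adjoint of this identity. *)
Lemma idempotent_adjK V W (f : V -> W) : bounded_op f ->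
  (forall h, f (adj f (f (adj f h))) = f (adj f h)) ->
  forall x, f (adj f (f x)) = f x.
Proof.
move=> fb idem x.
have gL := bounded_op_linear (bounded_adj fb).
have fL := bounded_op_linear fb.
have gfg h : adj f (f (adj f h)) = adj f h.
  apply/eqP; rewrite -subr_eq0; apply/eqP/inner_self_eq0.
  rewrite -(linfunB gL) adj_inner // (linfunB gL) (linfunB fL) idem subrr.
  by rewrite inner0r.
apply: inner_inj => z; rewrite [LHS]inner_conj [RHS]inner_conj; congr (_^*)%R.
by rewrite [LHS]inner_adj // [LHS]adj_inner // [LHS]inner_adj // gfg -inner_adj.
Qed.

(** This trades a condition on the orthogonal complement of a kernel for an algebraic identity,
    which can be transported by a representation of a C*-algebra. *)
Lemma partial_isometryP V W (f : V -> W) : partial_isometry f <->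
  bounded_op f /\ forall h, f (adj f (f (adj f h))) = f (adj f h).
Proof.
split=> [[fb fi]|[fb idem]]; split=> //.
  have gL := bounded_op_linear (bounded_adj fb).
  have fL := bounded_op_linear fb.
  move=> h; congr f.
  (* The range of f^* is orthogonal to ker f, so f preserves norms there; polarization upgrades this
     to inner products. *)
  have pol h1 h2 : inner (f (adj f h1)) (f (adj f h2)) - inner (adj f h1) (adj f h2) = 0.
    move: h1 h2; apply: polarization => [x y z|x y z|c x y|c x y|x].
    - by rewrite (linfunD gL) (linfunD fL) !innerDl; ring.
    - by rewrite (linfunD gL) (linfunD fL) !innerDr; ring.
    - by rewrite (linfunZ gL) (linfunZ fL) !innerZl; ring.
    - by rewrite (linfunZ gL) (linfunZ fL) !innerZr; ring.
    - rewrite !inner_norm fi ?subrr // => z fz.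
      by rewrite -inner_adj // fz inner0l.
  apply/eqP; rewrite -subr_eq0; apply/eqP/inner_self_eq0.
  by rewrite -{2}(linfunB gL) innerBl adj_inner //.
have fL := bounded_op_linear fb.
have fgf := idempotent_adjK fb idem.
(* By f f^* f = f the vector f^* f x - x lies in ker f, so x is orthogonal to it. *)
move=> x xk; have := xk (adj f (f x) - x).
rewrite (linfunB fL) fgf subrr => /(_ erefl)/eqP.
rewrite innerBl adj_inner // !inner_norm subr_eq0 eqrXn2 // => /eqP //.
Qed.

Lemma partial_isometryK V W (f : V -> W) : partial_isometry f ->
  forall x, f (adj f (f x)) = f x.
Proof.
by move=> /partial_isometryP[fb idem]; exact: idempotent_adjK.
Qed.

Lemma partial_isometry_initial V W (f : V -> W) x : partial_isometry f ->
  `|f x| = `|x| -> adj f (f x) = x.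
Proof.
move=> fp fx; have [fb _] := fp.
apply/eqP; rewrite -subr_eq0; apply/eqP/inner_self_eq0.
rewrite innerBr !innerBl !adj_inner // partial_isometryK //.
by rewrite -inner_adj // !inner_norm fx !subrr.
Qed.

(** The form <x, g y> - <g x, y> vanishes on the diagonal because <x, g x> is real. *)
Lemma positive_op_selfadj V (g : V -> V) : positive_op g ->
  forall x y, inner (g x) y = inner x (g y).
Proof.
move=> [gb g0] x y; have gL := bounded_op_linear gb.
apply/esym/eqP; rewrite -subr_eq0; apply/eqP.
apply: (polarization (B := fun x y => inner x (g y) - inner (g x) y)).
- by move=> a b c; rewrite (linfunD gL) !innerDl; ring.
- by move=> a b c; rewrite (linfunD gL) !innerDr; ring.
- by move=> c a b; rewrite (linfunZ gL) !innerZl; ring.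
- by move=> c a b; rewrite (linfunZ gL) !innerZr; ring.
- by move=> a; rewrite [inner (g a) a]inner_conj geC0_conj // subrr.
Qed.

(** [sqrt_op] is an arbitrary choice of positive square root, so uniqueness is the issue. A positive
    root g of p vanishes on ker p, whence g p = g. For v = g x - p x this gives g v = - v, and
    positivity of g forces v = 0. *)
Lemma sqrt_op_projection V (p : V -> V) : bounded_op p ->
  (forall x, p (p x) = p x) -> (forall x y, inner (p x) y = inner x (p y)) ->
  sqrt_op p = p.
Proof.
move=> pb pp ps.
have [gp gg] : [set g : V -> V | positive_op g /\ g \o g = p] (sqrt_op p).
  apply: xgetPex; exists p; split; last by apply/funext => x /=.
  by split=> // x; rewrite -pp -ps inner_norm exprn_ge0.
move: (sqrt_op p) gp gg => g gp /(congr1 (@^~ _)) gg.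
have gs := positive_op_selfadj gp; have [gb g0] := gp.
have gL := bounded_op_linear gb; have pL := bounded_op_linear pb.
have {}gg x : g (g x) = p x by exact: gg.
have gker x : p x = 0 -> g x = 0.
  by move=> px; apply: inner_self_eq0; rewrite gs gg px inner0r.
have gE x : g (p x) = g x.
  apply/esym/eqP; rewrite -subr_eq0 -(linfunB gL); apply/eqP/gker.
  by rewrite (linfunB pL) pp subrr.
apply/funext => x; apply/eqP; rewrite -subr_eq0; apply/eqP/inner_self_eq0.
have := g0 (g x - p x); rewrite (linfunB gL) gg gE.
have -> : p x - g x = - (g x - p x) by rewrite opprB.
rewrite innerNr oppr_ge0 inner_norm => h; apply/eqP; rewrite eq_le h exprn_ge0 //.
Qed.

End Partial_isometries.

Section Isometries.
Context {R : realType}.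
Implicit Types V W : hilbertType R.

Lemma isometric_norm V W (f : V -> W) x : isometric_embedding f -> `|f x| = `|x|.
Proof.
by case=> _ fi; apply/eqP; rewrite -(@eqrXn2 _ 2) // -!inner_norm fi.
Qed.

Lemma isometric_bounded V W (f : V -> W) : isometric_embedding f -> bounded_op f.
Proof.
move=> fi; apply/bounded_opP; split; first by case: fi.
by exists 1 => // x; rewrite mul1r isometric_norm.
Qed.

Lemma isometric_adjK V W (f : V -> W) x : isometric_embedding f -> adj f (f x) = x.
Proof.
move=> fi; apply: inner_inj => z.
by rewrite -inner_adj; [case: fi|exact: isometric_bounded].
Qed.

Lemma isometric_adj_le V W (f : V -> W) t : isometric_embedding f ->
  `|adj f t| <= `|t|.
Proof.
move=> fi; have fb := isometric_bounded fi.
have [->|n0] := eqVneq (adj f t) 0; first by rewrite normr0.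
have n0' : 0 < `|adj f t| by rewrite normr_gt0.
rewrite -(ler_pM2l n0') -expr2 -inner_norm adj_inner //.
rewrite -[inner _ _]ger0_norm; last by rewrite -adj_inner // inner_norm exprn_ge0.
by rewrite (le_trans (cauchy_schwarz _ _)) // mulrC isometric_norm.
Qed.

(** Apply f^* to the expansion f x = sum_e <e, f x> e and use <e, f x> = <f^* e, x>. *)
Lemma frame_isometric V W (f : V -> W) (u : seq W) : isometric_embedding f ->
  (forall x, frame_op u (f x) = f x) -> frame [seq adj f e | e <- u].
Proof.
move=> fi uf x; have fb := isometric_bounded fi.
rewrite -[RHS](isometric_adjK _ fi) -uf.
rewrite (linfun_sum (bounded_op_linear (bounded_adj fb))) /frame_op big_map.
apply: eq_bigr => e _; rewrite adj_inner //.
by rewrite (linfunZ (bounded_op_linear (bounded_adj fb))).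
Qed.

Lemma frame_finite_dim V : finite_dim V -> exists u : seq V, frame u.
Proof.
case=> d [b bP]; have [u hu] := gram_schmidt [seq b i | i <- enum 'I_d].
exists u => x; have [c ->] := bP x.
rewrite (linfun_sum (frame_op_linear u)); apply: eq_bigr => i _.
by rewrite (linfunZ (frame_op_linear u)) hu //; apply: map_f; rewrite mem_enum.
Qed.

Lemma closed_subspace_frame_op V (u : seq V) : closed_subspace [set t | frame_op u t = t].
Proof.
have := closed_subspace_ker (bounded_opB (bounded_frame_op u) (bounded_op_id V)).
congr closed_subspace; apply/funext => t /=; apply/propext.
by split=> [/eqP|->]; rewrite ?subrr // subr_eq0 => /eqP.
Qed.

End Isometries.

(** * Subproduct systems and the Fock space *)

Section Subproduct_systems.
Context {R : realType} {E : hilbertType R} {P : tensor_powers E}.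
Context (X : subproduct_system P).

Lemma sincl_linear n : linear (@sincl _ _ _ X n).
Proof. by case: (@sincl_isometric _ _ _ X n). Qed.

Lemma bounded_sincl n : bounded_op (@sincl _ _ _ X n).
Proof. exact/isometric_bounded/sincl_isometric. Qed.

Lemma inner_sincl n (x y : X n) : inner (sincl x) (sincl y) = inner x y.
Proof. by case: (@sincl_isometric _ _ _ X n). Qed.

(** For an isometric inclusion i, the orthogonal projection onto its range is i i^*; read as an
    element of X(n), the projection of t is thus i^* t. *)
Lemma sprojE n (t : P n) : sproj X t = adj (@sincl _ _ _ X n) t.
Proof.
have sb := bounded_sincl n.
have h : [set x : X n | forall y : X n, inner (sincl y) (t - sincl x) = 0] (sproj X t).
  apply: xgetPex; exists (adj (@sincl _ _ _ X n) t) => y.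
  by rewrite innerBr inner_sincl inner_adj // subrr.
apply: inner_inj => y; rewrite -inner_adj // -inner_sincl.
by apply/esym/eqP; rewrite -subr_eq0 -innerBr h.
Qed.

Lemma inner_smul n m (x : X n) (y : X m) z :
  inner (smul x y) z = inner (tmul (sincl x) (sincl y)) (sincl z).
Proof. by rewrite /smul sprojE adj_inner //; exact: bounded_sincl. Qed.

Lemma smul_linearr n m (x : X n) : linear (fun y : X m => smul x y).
Proof.
move=> c y y'; apply: inner_inj => z.
rewrite inner_conj inner_smul sincl_linear tmul_linearr -inner_conj.
by rewrite !innerDr !innerZr [inner z (smul x y)]inner_conj [inner z _]inner_conj
  !inner_smul -!inner_conj.
Qed.

Lemma norm_tmul n m (x : P n) (y : P m) : `|tmul x y| = `|x| * `|y|.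
Proof.
apply/eqP; rewrite -(@eqrXn2 _ 2) ?mulr_ge0 //.
by rewrite exprMn -!inner_norm tmul_inner.
Qed.

Lemma norm_smul_le n m (x : X n) (y : X m) : `|smul x y| <= `|x| * `|y|.
Proof.
rewrite /smul sprojE (le_trans (isometric_adj_le _ (@sincl_isometric _ _ _ X _))) //.
by rewrite norm_tmul !isometric_norm //; exact: sincl_isometric.
Qed.

(** The products of frame vectors reproduce the closed span of X(n) (x) X(m) in the tensor power. By
    [sincl_mul] that span contains X(n+m), so their projections form a frame of X(n+m). *)
Lemma frame_smul n m (u : seq (X n)) (v : seq (X m)) : frame u -> frame v ->
  frame [seq smul x y | x <- u, y <- v].
Proof.
move=> uF vF; pose w := [seq tmul (sincl x) (sincl y) | x <- u, y <- v].
have -> : [seq smul x y | x <- u, y <- v] = [seq adj (@sincl _ _ _ X _) t | t <- w].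
  by rewrite map_allpairs; apply: eq_allpairs => x y; rewrite /smul sprojE.
apply: frame_isometric; first exact: sincl_isometric.
move=> z; have : range (@sincl _ _ _ X (n + m)%N) (sincl z) by exists z.
move=> /(sincl_mul (s := X)).
apply: (closed_span_min (closed_subspace_frame_op w)) => _ [x [y ->]] /=.
rewrite -[in RHS](uF x) -[in RHS](vF y) /frame_op big_allpairs_dep.
rewrite (linfun_sum (sincl_linear (n := n))) (linfun_sum (tmul_linearl _)).
apply: eq_bigr => a _.
rewrite (linfunZ (sincl_linear (n := n))) (linfunZ (tmul_linearl _)).
rewrite (linfun_sum (sincl_linear (n := m))) (linfun_sum (tmul_linearr _)).
rewrite scaler_sumr; apply: eq_bigr => b _.
rewrite (linfunZ (sincl_linear (n := m))) (linfunZ (tmul_linearr _)).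
by rewrite scalerA tmul_inner !inner_sincl.
Qed.

Lemma tpure0 (v : 'I_0 -> E) : tpure P v = tone P.
Proof. by congr tpure; apply/funext => -[]. Qed.

Lemma norm_tone : `|tone P| = 1.
Proof.
by apply/eqP; rewrite -(@eqrXn2 _ 2) // -inner_norm tpure_inner big_ord0 expr1n.
Qed.

Lemma frame_op_tone (t : P 0%N) : frame_op [:: tone P] t = t.
Proof.
apply: (closed_span_total (tpure_total P 0) (closed_subspace_frame_op _)) => _ [v ->].
by rewrite /= /frame_op big_seq1 tpure0 inner_norm norm_tone expr1n scale1r.
Qed.

Lemma sunit_exists : exists x : X 0%N, sincl x = tone P.
Proof.
have : [set: P 0%N] (tone P) by [].
by rewrite -(sincl0 X) => -[x _ <-]; exists x.
Qed.

Definition sunit : X 0%N := xget 0 [set x : X 0%N | sincl x = tone P].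

Lemma sincl_sunit : sincl sunit = tone P.
Proof. exact: (@xgetPex _ 0 [set x : X 0%N | sincl x = tone P] sunit_exists). Qed.

Lemma frame_sunit : frame [:: sunit].
Proof.
have := @frame_isometric _ _ _ _ [:: tone P] (@sincl_isometric _ _ _ X 0%N)
  (fun x => frame_op_tone (sincl x)).
by rewrite /= -sincl_sunit isometric_adjK //; exact: sincl_isometric.
Qed.

(** A frame of E is first carried to the model [P 1] of E by the linear isometry [tp] and then
    compressed to X(1). *)
Lemma frame_exists1 : finite_dim E -> exists u : seq (X 1%N), frame u.
Proof.
move=> /frame_finite_dim[u uF].
pose tp (x : E) := tpure P (fun _ : 'I_1 => x).
have tpL : linear tp.
  have := tpure_linear P (fun _ : 'I_1 => 0) ord0.
  suff -> : (fun x : E => tpure P (fun j : 'I_1 => if j == ord0 then x else 0)) = tp by [].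
  by apply/funext => x; congr tpure; apply/funext => j; rewrite ord1 eqxx.
exists [seq adj (@sincl _ _ _ X 1%N) t | t <- [seq tp e | e <- u]].
apply: frame_isometric; first exact: sincl_isometric.
move=> z; apply: (closed_span_total (tpure_total P 1) (closed_subspace_frame_op _)).
move=> _ [v ->] /=; have -> : tpure P v = tp (v ord0).
  by congr tpure; apply/funext => j; rewrite ord1.
rewrite -[in RHS](uF (v ord0)) /frame_op (linfun_sum tpL) big_map.
apply: eq_bigr => e _.
by rewrite (linfunZ tpL) tpure_inner big_ord1.
Qed.

Lemma frame_exists n : finite_dim E -> exists u : seq (X n), frame u.
Proof.
move=> Ef; have [u1 u1F] := frame_exists1 Ef.
elim: n => [|n [u uF]]; first by exists [:: sunit]; exact: frame_sunit.
by exists [seq smul x y | x <- u1, y <- u]; exact: (frame_smul u1F uF).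
Qed.

(** [n + 0] and [n] are not convertible, so t (x) 1 can be compared with t only through a
    transport. *)
Definition tcast n m (e : n = m) (t : P n) : P m := eq_rect n (fun k => P k) t m e.

Lemma bounded_tcast n m (e : n = m) : bounded_op (tcast e).
Proof. by case: _ / e; exact: bounded_op_id. Qed.

Lemma tcast_pure n m (e : n = m) (v : 'I_n -> E) :
  tcast e (tpure P v) = tpure P (fun j => v (cast_ord (esym e) j)).
Proof.
case: _ / e; rewrite /tcast /=; congr tpure; apply/funext => j.
by congr v; apply: val_inj.
Qed.

Lemma range_sincl_tcast n m (e : n = m) (x : X n) :
  range (@sincl _ _ _ X m) (tcast e (sincl x)).
Proof. by case: _ / e; exists x. Qed.

Lemma tmul_tone n (t : P n) : tmul t (tone P) = tcast (esym (addn0 n)) t.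
Proof.
have b : bounded_op (fun t : P n => tmul t (tone P)).
  apply/bounded_opP; split; first exact: tmul_linearl.
  by exists 1 => // x; rewrite norm_tmul norm_tone mulr1 mul1r.
suff e : (fun t : P n => tmul t (tone P)) = tcast (esym (addn0 n)).
  exact: (congr1 (@^~ t) e).
apply: (bounded_op_eq (tpure_total P n) b (bounded_tcast _)) => _ [v ->].
rewrite tmul_pure tcast_pure; congr tpure; apply/funext => k; rewrite /ord_cat.
by case: fintype.splitP => [j kj|[]//]; congr v; apply: val_inj.
Qed.

(** The tensor x (x) 1 is a transport of x, hence already lies in X(n+0), and the projection fixes
    it. Comparing norms keeps the transport out of the statement. *)
Lemma norm_smul_sunit n (x : X n) : `|smul x sunit| = `|x|.
Proof.
have [z _ zP] := range_sincl_tcast (esym (addn0 n)) x.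
rewrite /smul sprojE sincl_sunit tmul_tone -zP isometric_adjK; last exact: sincl_isometric.
rewrite -(isometric_norm z (@sincl_isometric _ _ _ X _)) zP -tmul_tone norm_tmul.
by rewrite norm_tone mulr1 isometric_norm //; exact: sincl_isometric.
Qed.

End Subproduct_systems.

(** * Operators on orthogonal direct sums *)

Section Hilbert_sums.
Context {R : realType} {V : nat -> hilbertType R} (F : hilbert_sum V).

Lemma inner_inj_total (K : hilbertType R) (A : set K) (x y : K) :
  closed_span A = setT -> (forall a, A a -> inner a x = inner a y) -> x = y.
Proof.
move=> AT h; apply/eqP; rewrite -subr_eq0; apply/eqP/inner_self_eq0.
apply: (closed_span_total AT (closed_subspace_orth _ (bounded_op_id K))).
by move=> a Aa /=; rewrite inner_conj innerBr h // subrr conjC0.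
Qed.

Lemma inner_hs_in n (x y : V n) : inner (hs_in F x) (hs_in F y) = inner x y.
Proof. by case: (hs_in_isometric F n). Qed.

Lemma hs_in_linear n : linear (@hs_in _ _ F n).
Proof. by case: (hs_in_isometric F n). Qed.

Lemma bounded_hs_in n : bounded_op (@hs_in _ _ F n).
Proof. exact/isometric_bounded/hs_in_isometric. Qed.

Lemma hs_bounded_op_eq (K : hilbertType R) (f g : F -> K) :
  bounded_op f -> bounded_op g ->
  (forall n (x : V n), f (hs_in F x) = g (hs_in F x)) -> f = g.
Proof.
by move=> fb gb fg; apply: (bounded_op_eq (hs_in_total F) fb gb) => _ [n [x ->]].
Qed.

Lemma hs_inner_inj (x y : F) :
  (forall n (z : V n), inner (hs_in F z) x = inner (hs_in F z) y) -> x = y.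
Proof. by move=> h; apply: (inner_inj_total (hs_in_total F)) => _ [n [z ->]]. Qed.

Lemma norm_orthogonal_sum (K : hilbertType R) N (g : nat -> K) :
  (forall n m, n <> m -> inner (g n) (g m) = 0) ->
  `|\sum_(m < N) g m| ^+ 2 = \sum_(m < N) `|g m| ^+ 2.
Proof.
move=> go; elim: N => [|N IH]; first by rewrite !big_ord0 normr0 expr0n.
rewrite !big_ord_recr /= pythagoras ?IH // inner_suml big1 // => i _.
by rewrite go //; apply/eqP; rewrite ltn_eqF.
Qed.

Let vec (p : {n & V n}) : F := hs_in F (projT2 p).

Lemma hs_total_vec : closed_span [set x | exists p, x = vec p] = setT.
Proof.
rewrite -(hs_in_total F); congr closed_span; apply/funext => t; apply/propext.
by split=> [[[n x] ->]|[n [x ->]]]; [exists n, x|exists (existT _ n x)].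
Qed.

(** A list may hold several vectors of the same degree; grouping them by degree is what makes
    orthogonality applicable. Validity for all large N lets the expansions for two different
    families be cut at a common N. *)
Lemma hs_lincomb (K : hilbertType R) (f : forall n, V n -> K) :
  (forall n, linear (f n)) -> forall s, exists N0, forall N, (N0 <= N)%N ->
  lincomb (fun p : {n & V n} => f _ (projT2 p)) s =
  \sum_(m < N) f m (adj (@hs_in _ _ F m) (lincomb vec s)).
Proof.
move=> fL; have aL m := bounded_op_linear (bounded_adj (bounded_hs_in m)).
elim=> [|[c [n x]] s [N0 IH]].
  exists 0%N => N _; rewrite /lincomb !big_nil big1 // => m _.
  by rewrite (linfun0 (aL m)) (linfun0 (fL m)).
exists (maxn N0 n.+1) => N; rewrite geq_max => /andP[N0N nN].
rewrite !lincomb_cons (IH _ N0N) /=.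
under [RHS]eq_bigr => m _ do
  rewrite (linfunD (aL m)) (linfunD (fL m)) (linfunZ (aL m)) (linfunZ (fL m)).
rewrite big_split /=; congr (_ + _).
rewrite (bigD1 (Ordinal nN)) //= big1 => [|m mn]; last first.
  suff -> : adj (@hs_in _ _ F m) (hs_in F x) = 0 by rewrite (linfun0 (fL m)) scaler0.
  apply: inner_inj => z; rewrite -inner_adj; last exact: bounded_hs_in.
  rewrite inner0r hs_in_orthogonal // => e; move/eqP: mn; apply.
  by apply: val_inj.
by rewrite addr0 isometric_adjK //; exact: hs_in_isometric.
Qed.

(** Orthogonality in the source and in the target lets Pythagoras add the degreewise bounds, so the
    uniform constant C survives. *)
Lemma hilbert_sum_extension (K : hilbertType R) (f : forall n, V n -> K) (C : R[i]) :
  0 <= C -> (forall n, linear (f n)) -> (forall n x, `|f n x| <= C * `|x|) ->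
  (forall n m x y, n <> m -> inner (f n x) (f m y) = 0) ->
  exists S : F -> K, bounded_op S /\ forall n (x : V n), S (hs_in F x) = f n x.
Proof.
move=> C0 fL fC fo.
have [|S [Sb SP]] := @bounded_extension _ _ _ _ vec
  (fun p : {n & V n} => f _ (projT2 p)) C C0 hs_total_vec.
  move=> s; have [N1 h1] := hs_lincomb fL s; have [N2 h2] := hs_lincomb hs_in_linear s.
  pose N := maxn N1 N2.
  rewrite -(@ler_pXn2r _ 2) ?nnegrE ?mulr_ge0 // exprMn.
  rewrite (h1 N) ?leq_maxl //.
  have -> : `|lincomb vec s| ^+ 2 =
      \sum_(m < N) `|adj (@hs_in _ _ F m) (lincomb vec s)| ^+ 2.
    rewrite [in LHS](h2 N) ?leq_maxr //.
    rewrite (norm_orthogonal_sum N (g := fun m => hs_in F (adj (@hs_in _ _ F m) _))).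
      by apply: eq_bigr => m _; rewrite isometric_norm //; exact: hs_in_isometric.
    by move=> n m nm; exact: hs_in_orthogonal.
  rewrite (norm_orthogonal_sum N (g := fun m => f m (adj (@hs_in _ _ F m) _))).
    rewrite mulr_sumr; apply: ler_sum => m _.
    by rewrite -exprMn ler_pXn2r ?nnegrE ?mulr_ge0.
  by move=> n m nm; exact: fo.
by exists S; split=> // n x; exact: (SP (existT _ n x)).
Qed.

End Hilbert_sums.

(** * Shifts, their adjoints and the vacuum projection *)

Section Fock_space.
Context {R : realType} {E : hilbertType R} {P : tensor_powers E}.
Context {X : subproduct_system P} (F : hilbert_sum X).

Local Notation shift x := (@fock_shift _ _ _ _ F _ x).

Lemma fock_shift_spec n (x : X n) : bounded_op (shift x) /\
  forall m (y : X m), shift x (hs_in F y) = hs_in F (smul x y).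
Proof.
apply: (@xgetPex _ _ [set S : F -> F |
    bounded_op S /\ forall m (y : X m), S (hs_in F y) = hs_in F (smul x y)]).
apply: (hilbert_sum_extension F (f := fun m y => hs_in F (smul x y)) (C := `|x|)) => //.
- move=> m; apply: (linear_comp (f := @hs_in _ _ F _) (g := fun y => smul x y)).
    exact: hs_in_linear.
  exact: smul_linearr.
- move=> m y; rewrite isometric_norm; last exact: hs_in_isometric.
  exact: norm_smul_le.
- move=> m m' y y' mm'; apply: hs_in_orthogonal => /eqP.
  by rewrite eqn_add2l => /eqP.
Qed.

Lemma bounded_fock_shift n (x : X n) : bounded_op (shift x).
Proof. by case: (fock_shift_spec x). Qed.

Lemma fock_shift_in n (x : X n) m (y : X m) :
  shift x (hs_in F y) = hs_in F (smul x y).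
Proof. by case: (fock_shift_spec x). Qed.

Lemma adj_fock_shift_in n (x : X n) k (v : seq (X k)) (z : X (n + k)%N) :
  frame v -> adj (shift x) (hs_in F z) =
             hs_in F (\sum_(f <- v) inner (smul x f) z *: f).
Proof.
move=> vF; apply: hs_inner_inj => j w.
rewrite -inner_adj ?fock_shift_in; last exact: bounded_fock_shift.
have [jk|jk] := eqVneq j k; last first.
  rewrite !hs_in_orthogonal //; first exact/eqP.
  by move/eqP; rewrite eqn_add2l; exact/negP.
subst j; rewrite !inner_hs_in -[in LHS](vF w) (linfun_sum (smul_linearr _)).
rewrite inner_suml inner_sumr; apply: eq_bigr => f _.
rewrite (linfunZ (smul_linearr _)) innerZl innerZr inner_swap_conj.
by rewrite mulrC.
Qed.

Lemma adj_fock_shift_in0 n (x : X n) k (z : X k) : (k < n)%N ->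
  adj (shift x) (hs_in F z) = 0.
Proof.
move=> kn; apply: hs_inner_inj => j w.
rewrite -inner_adj ?fock_shift_in; last exact: bounded_fock_shift.
rewrite inner0r hs_in_orthogonal // => e.
by move: kn; rewrite -e ltnNge leq_addr.
Qed.

(* S~_n S~_n^*, the projection onto the sum of the X(m), m >= n. *)
Definition shift_range n (u : seq (X n)) (t : F) : F :=
  \sum_(e <- u) shift e (adj (shift e) t).

Lemma bounded_shift_range n (u : seq (X n)) : bounded_op (shift_range u).
Proof.
apply: (bounded_op_sum u (f := fun e t => shift e (adj (shift e) t))) => e.
apply: (bounded_op_comp (f := shift e)); first exact: bounded_fock_shift.
exact/bounded_adj/bounded_fock_shift.
Qed.

Hypothesis Ef : finite_dim E.

(** With a frame of X(k) inserted in the formula for the adjoint shift, the sum becomes the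
    expansion of z in the product frame of X(n+k). *)
Lemma shift_range_in n (u : seq (X n)) k (z : X (n + k)%N) : frame u ->
  shift_range u (hs_in F z) = hs_in F z.
Proof.
move=> uF; have [v vF] := frame_exists X k Ef.
rewrite -[in RHS](frame_smul uF vF z) /frame_op big_allpairs_dep.
rewrite (linfun_sum (hs_in_linear F (n := _))); apply: eq_bigr => e _.
rewrite (adj_fock_shift_in _ _ vF) fock_shift_in (linfun_sum (smul_linearr _)).
by congr hs_in; apply: eq_bigr => f _; rewrite (linfunZ (smul_linearr _)).
Qed.

Lemma shift_range_in0 n (u : seq (X n)) k (z : X k) : (k < n)%N ->
  shift_range u (hs_in F z) = 0.
Proof.
move=> kn; rewrite /shift_range big1 // => e _.
by rewrite adj_fock_shift_in0 // (linfun0 (bounded_op_linear (bounded_fock_shift e))).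
Qed.

Lemma shift_range_id (u : seq (X 0%N)) : frame u -> shift_range u = id.
Proof.
move=> uF; apply: (hs_bounded_op_eq (bounded_shift_range u) (bounded_op_id F)) => n x.
exact: (shift_range_in (n := 0%N) (k := n)).
Qed.

Lemma shift_range_idem n (u : seq (X n)) : frame u ->
  shift_range u \o shift_range u = shift_range u.
Proof.
move=> uF; have b := bounded_shift_range u.
apply: (hs_bounded_op_eq (bounded_op_comp b b) b) => k z /=.
have [kn|nk] := ltnP k n.
  by rewrite !shift_range_in0 // (linfun0 (bounded_op_linear b)).
by move: z; rewrite -(subnKC nk) => z; rewrite !shift_range_in.
Qed.

Lemma vacuum_in0 (u : seq (X 1%N)) (z : X 0%N) :
  hs_in F z - shift_range u (hs_in F z) = hs_in F z.
Proof. by rewrite shift_range_in0 // subr0. Qed.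

(** Both sides vanish in positive degree. On X(0) the adjoint shift brings x (x) 1 back to degree 0
    with coefficient |x (x) 1|^2 = |x|^2. *)
Lemma vacuum_compression (u : seq (X 1%N)) n (x : X n) (t : F) : frame u ->
  let p := fun t => t - shift_range u t in
  p (adj (shift x) (shift x (p t))) = `|x| ^+ 2 *: p t.
Proof.
move=> uF p.
have pb : bounded_op p := bounded_opB (bounded_op_id F) (bounded_shift_range u).
have Sb := bounded_fock_shift x.
have b : bounded_op (fun t => p (adj (shift x) (shift x (p t)))).
  apply: (bounded_op_comp pb); apply: (bounded_op_comp (bounded_adj Sb)).
  exact: (bounded_op_comp Sb pb).
suff /(congr1 (@^~ t)) : (fun t => p (adj (shift x) (shift x (p t)))) =
  (fun t => `|x| ^+ 2 *: p t) by [].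
apply: (hs_bounded_op_eq b (bounded_opZ _ pb)) => -[|k] z.
  rewrite /p vacuum_in0 fock_shift_in (adj_fock_shift_in _ _ (@frame_sunit _ _ _ X)) big_seq1.
  rewrite vacuum_in0 -[z in LHS](frame_sunit z) /frame_op big_seq1.
  rewrite (linfunZ (smul_linearr _)) innerZr inner_norm norm_smul_sunit mulrC -scalerA.
  rewrite (linfunZ (hs_in_linear F (n := _))); congr (_ *: hs_in F _).
  by rewrite -[RHS](frame_sunit z) /frame_op big_seq1.
have -> : p (hs_in F z) = 0 by rewrite /p (shift_range_in (n := 1) (k := k)) ?subrr.
have pL := bounded_op_linear pb.
by rewrite (linfun0 (bounded_op_linear Sb)) (linfun0 (bounded_op_linear (bounded_adj Sb)))
  (linfun0 pL) scaler0.
Qed.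

End Fock_space.

(** * Representations *)

Section Tensor.
Context {R : realType} {V W : hilbertType R} (VW : hilbert_tensor V W).

Lemma norm_tens (v : V) (w : W) : `|tens VW v w| = `|v| * `|w|.
Proof.
apply/eqP; rewrite -(@eqrXn2 _ 2) ?mulr_ge0 //.
by rewrite exprMn -!inner_norm tens_inner.
Qed.

Lemma bounded_tens (v : V) : bounded_op (tens VW v).
Proof.
apply/bounded_opP; split; first exact: tens_linearr.
by exists `|v| => // w; rewrite norm_tens.
Qed.

Lemma adj_tens (e v : V) (w : W) : adj (tens VW e) (tens VW v w) = inner e v *: w.
Proof.
apply: inner_inj => z; rewrite -inner_adj; last exact: bounded_tens.
by rewrite tens_inner innerZr.
Qed.

End Tensor.

Section Representation.
Context {R : realType} {E : hilbertType R} {P : tensor_powers E}.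
Context {X : subproduct_system P} {H : hilbertType R}.
Context (XH : forall n, hilbert_tensor (X n) H) (T : forall n, X n -> H -> H).
Hypotheses (Ef : finite_dim E) (TP : cc_covariant_representation T).

Local Notation tilde n := (@rep_tilde _ _ _ _ _ XH T n).

Lemma repZD n (c : R[i]) (x y : X n) h : T (c *: x + y) h = c *: T x h + T y h.
Proof. by rewrite (rep_linear TP). Qed.

Lemma rep_sum n I (r : seq I) (c : I -> R[i]) (x : I -> X n) h :
  T (\sum_(i <- r) c i *: x i) h = \sum_(i <- r) c i *: T (x i) h.
Proof.
have TL : linear (T (n := n)) := rep_linear TP (n := n).
rewrite (linfun_sum TL) fct_sumE; apply: eq_bigr => i _.
by rewrite (linfunZ TL).
Qed.

Lemma rep_frame n (u : seq (X n)) (x : X n) h : frame u ->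
  T x h = \sum_(e <- u) inner e x *: T e h.
Proof. by move=> uF; rewrite -[x in LHS]uF rep_sum. Qed.

Lemma rep_smul n m (x : X n) (y : X m) h : T (smul x y) h = T x (T y h).
Proof. by rewrite (rep_mul TP). Qed.

Lemma rep_sunit : T (sunit X) = id.
Proof.
rewrite (rep0 TP (c := 1)); first by apply/funext => h; rewrite scale1r.
by rewrite scale1r sincl_sunit.
Qed.

(** For a finite frame of X(n), the finite sum of the T_n(e) (e (x) -)^* is an explicit bounded
    candidate, so [rep_tilde] is not the default value. *)
Lemma rep_tilde_spec n :
  bounded_op (tilde n) /\ forall x h, tilde n (tens (XH n) x h) = T x h.
Proof.
apply: (@xgetPex _ _ [set f : XH n -> H |
    bounded_op f /\ forall x h, f (tens (XH n) x h) = T x h]).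
have [u uF] := frame_exists X n Ef.
exists (fun t => \sum_(e <- u) T e (adj (tens (XH n) e) t)); split.
  apply: (bounded_op_sum u (f := fun e t => T e (adj (tens (XH n) e) t))) => e.
  apply: (bounded_op_comp (f := T e)); first exact: rep_bounded.
  exact/bounded_adj/bounded_tens.
move=> x h; rewrite (rep_frame _ _ uF); apply: eq_bigr => e _.
by rewrite adj_tens (linfunZ (bounded_op_linear (rep_bounded TP e))).
Qed.

Lemma bounded_rep_tilde n : bounded_op (tilde n).
Proof. by case: (rep_tilde_spec n). Qed.

Lemma rep_tilde_tens n x h : tilde n (tens (XH n) x h) = T x h.
Proof. by case: (rep_tilde_spec n). Qed.

Lemma adj_rep_tilde n (u : seq (X n)) h : frame u ->
  adj (tilde n) h = \sum_(e <- u) tens (XH n) e (adj (T e) h).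
Proof.
move=> uF; apply: (inner_inj_total (tens_total (XH n))) => _ [x [k ->]].
rewrite -inner_adj ?rep_tilde_tens; last exact: bounded_rep_tilde.
rewrite (rep_frame _ _ uF) inner_sumr inner_suml; apply: eq_bigr => e _.
rewrite tens_inner innerZl inner_swap_conj inner_adj //.
exact: rep_bounded.
Qed.

Definition rep_range n h := tilde n (adj (tilde n) h).

Lemma rep_rangeE n (u : seq (X n)) h : frame u ->
  rep_range n h = \sum_(e <- u) T e (adj (T e) h).
Proof.
move=> uF; rewrite /rep_range (adj_rep_tilde _ uF).
rewrite (linfun_sum (bounded_op_linear (bounded_rep_tilde n))).
by apply: eq_bigr => e _; rewrite rep_tilde_tens.
Qed.

Lemma bounded_rep_range n : bounded_op (rep_range n).
Proof.
have b := bounded_rep_tilde n.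
exact: (bounded_op_comp b (bounded_adj b)).
Qed.

Lemma rep_range_selfadj n x y : inner (rep_range n x) y = inner x (rep_range n y).
Proof.
have b := bounded_rep_tilde n.
by rewrite /rep_range inner_adj // adj_inner.
Qed.

Lemma rep_range0 h : rep_range 0 h = h.
Proof.
rewrite (rep_rangeE _ (@frame_sunit _ _ _ X)) big_seq1 rep_sunit.
by rewrite (@adj_unique _ _ _ id id).
Qed.

(** In a product frame of X(n) and X(1), T_(n+1) factors as T_n T_1 and the sum over X(1) collapses
    to T~_1 T~_1^*. *)
Lemma rep_rangeS n (u : seq (X n)) h : frame u ->
  rep_range n.+1 h = \sum_(e <- u) T e (rep_range 1 (adj (T e) h)).
Proof.
move=> uF; have [v vF] := frame_exists X 1 Ef.
rewrite -addn1 (rep_rangeE _ (frame_smul uF vF)) big_allpairs_dep.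
apply: eq_bigr => e _; have Te := rep_bounded TP e.
rewrite (rep_rangeE _ vF) (linfun_sum (bounded_op_linear Te)).
apply: eq_bigr => f _; rewrite rep_smul (rep_mul TP) adj_comp //.
exact: rep_bounded.
Qed.

Lemma Delta_starE : (forall h, rep_range 1 (rep_range 1 h) = rep_range 1 h) ->
  Delta_star XH T = fun h => h - rep_range 1 h.
Proof.
move=> idem; have b := bounded_rep_range 1; have bL := bounded_op_linear b.
apply: (sqrt_op_projection (p := fun h => h - rep_range 1 h)).
- exact: (bounded_opB (bounded_op_id H) b).
- by move=> h; rewrite (linfunB bL) idem subrr subr0.
- by move=> x y; rewrite innerBl innerBr rep_range_selfadj.
Qed.

End Representation.

(** * From extensions to relative isometries *)

Section Generated_cstar_algebra.
Context {R : realType} {V : hilbertType R}.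
Implicit Types (A G : set (V -> V)).

(** B(V) is a member of the family intersected in [cstar_generated], which is why generated elements
    are bounded. *)
Lemma cstar_subalgebra_bounded : cstar_subalgebra [set a : V -> V | bounded_op a].
Proof.
split=> //.
- split; first exact: bounded_op0.
  by move=> c a b /= ab bb; exact: bounded_op_lincomb.
- by move=> a b /= ab bb; exact: bounded_op_comp.
- by move=> a; exact: bounded_adj.
Qed.

Lemma cstar_generated_subalgebra G :
  G `<=` [set a : V -> V | bounded_op a] -> cstar_subalgebra (cstar_generated G).
Proof.
move=> Gb; split.
- by move=> a; apply; split; [exact: cstar_subalgebra_bounded|].
- split; first by move=> B [[_ [B0 _] _ _ _] _].
  move=> c a b Aa Ab B GB; have [[_ [_ BL] _ _ _] _] := GB.
  by apply: BL; [exact: Aa|exact: Ab].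
- move=> a b Aa Ab B GB; have [[_ _ BM _ _] _] := GB.
  by apply: BM; [exact: Aa|exact: Ab].
- move=> a Aa B GB; have [[_ _ _ BA _] _] := GB.
  by apply: BA; exact: Aa.
- move=> a ab h B GB; have [[_ _ _ _ BC] _] := GB.
  apply: BC => // e e0; have [b Ab hb] := h e e0.
  by exists b => //; exact: Ab.
Qed.

Lemma sub_cstar_generated G : G `<=` cstar_generated G.
Proof. by move=> a Ga B [_]; exact. Qed.

End Generated_cstar_algebra.

Section Cstar_representation.
Context {R : realType} {V W : hilbertType R} (A : set (V -> V)).
Context (pi : (V -> V) -> (W -> W)).
Hypotheses (AP : cstar_subalgebra A) (piP : cstar_representation A pi).

Lemma cstar_mem0 : A 0.
Proof. by case: AP => _ []. Qed.

Lemma cstar_memL c a b : A a -> A b -> A (c *: a + b).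
Proof. by case: AP => _ [_ h] _ _ _; exact: h. Qed.

Lemma cstar_memM a b : A a -> A b -> A (a \o b).
Proof. by case: AP => _ _ h _ _; exact: h. Qed.

Lemma cstar_mem_adj a : A a -> A (adj a).
Proof. by case: AP => _ _ _ h _; exact: h. Qed.

Lemma cstar_mem_sum I (r : seq I) (f : I -> V -> V) :
  (forall i, A (f i)) -> A (\sum_(i <- r) f i).
Proof.
move=> Af; elim/big_ind: _ => //; first exact: cstar_mem0.
by move=> a b Aa Ab; rewrite -[a]scale1r; exact: cstar_memL.
Qed.

Lemma cstar_repL c a b : A a -> A b -> pi (c *: a + b) = c *: pi a + pi b.
Proof. by case: piP => _ h _ _ _; exact: h. Qed.

Lemma cstar_repM a b : A a -> A b -> pi (a \o b) = pi a \o pi b.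
Proof. by case: piP => _ _ h _ _; exact: h. Qed.

Lemma cstar_rep_adj a : A a -> pi (adj a) = adj (pi a).
Proof. by case: piP => _ _ _ h _; exact: h. Qed.

Lemma cstar_rep0 : pi 0 = 0.
Proof.
have := cstar_repL (-1) cstar_mem0 cstar_mem0.
by rewrite scaler0 add0r scaleN1r addNr.
Qed.

Lemma cstar_repZ c a : A a -> pi (c *: a) = c *: pi a.
Proof.
by move=> Aa; rewrite -[c *: a]addr0 (cstar_repL _ Aa cstar_mem0) cstar_rep0 addr0.
Qed.

Lemma cstar_rep_sum I (r : seq I) (f : I -> V -> V) :
  (forall i, A (f i)) -> pi (\sum_(i <- r) f i) = \sum_(i <- r) pi (f i).
Proof.
move=> Af; elim: r => [|i r IH]; first by rewrite !big_nil cstar_rep0.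
rewrite !big_cons -[f i]scale1r (cstar_repL _ (Af i)) ?IH ?scale1r //.
exact: cstar_mem_sum.
Qed.

End Cstar_representation.

Section Extension_to_relatively_isometric.
Context {R : realType} {E : hilbertType R} {P : tensor_powers E}.
Context {X : subproduct_system P} {H : hilbertType R}.
Context (XH : forall n, hilbert_tensor (X n) H) (F : hilbert_sum X).
Context (T : forall n, X n -> H -> H).
Hypotheses (Ef : finite_dim E) (TP : cc_covariant_representation T).

Local Notation shift x := (@fock_shift _ _ _ _ F _ x).
Local Notation shrange u := (@shift_range _ _ _ _ F _ u).

Lemma toeplitz_subalgebra : cstar_subalgebra (@toeplitz _ _ _ _ F).
Proof.
apply: cstar_generated_subalgebra => _ [n [x ->]].
exact: bounded_fock_shift.
Qed.

Lemma toeplitz_shift n (x : X n) : toeplitz (shift x).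
Proof. by apply: sub_cstar_generated; exists n, x. Qed.

Lemma extension_relatively_isometric :
  extends_to_cstar_representation F T -> relatively_isometric XH T.
Proof.
case=> pi [piP piT]; have AP := toeplitz_subalgebra.
have AS n (x : X n) := toeplitz_shift x.
have shift_rangeE n (u : seq (X n)) :
    shrange u = \sum_(e <- u) (shift e \o adj (shift e)).
  by apply/funext => t; rewrite fct_sumE.
have AP2 n (x : X n) : toeplitz (shift x \o adj (shift x)).
  by apply: (cstar_memM AP); last exact: (cstar_mem_adj AP).
have AQ n (u : seq (X n)) : toeplitz (shrange u).
  by rewrite shift_rangeE; exact: (cstar_mem_sum AP).
have piQ n (u : seq (X n)) : frame u -> pi (shrange u) = rep_range XH T n.
  move=> uF; rewrite shift_rangeE (cstar_rep_sum AP piP) //.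
  apply/funext => h; rewrite fct_sumE (rep_rangeE XH Ef TP _ uF).
  apply: eq_bigr => e _; rewrite (cstar_repM piP) //; last exact: (cstar_mem_adj AP).
  by rewrite (cstar_rep_adj piP) // piT.
(* The range projection on the Fock space is idempotent, and pi carries this identity over to T~_n
   T~_n^*. *)
have idem n h : rep_range XH T n (rep_range XH T n h) = rep_range XH T n h.
  have [u uF] := frame_exists X n Ef.
  rewrite -(piQ _ _ uF); have /(congr1 pi) := shift_range_idem F Ef uF.
  by rewrite (cstar_repM piP) // => /(congr1 (@^~ h)).
split.
  by move=> n; apply/partial_isometryP; split; [exact: bounded_rep_tilde|exact: idem].
right=> n x h; rewrite (Delta_starE Ef TP (idem 1)).
have [u uF] := frame_exists X 1 Ef.
(* The identity has to be exhibited as an element of the Toeplitz algebra: it is S_0(1) S_0(1)^*,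
   the range projection in degree 0. *)
pose p : F -> F := (-1) *: shrange u + shrange [:: sunit X].
have pE t : p t = t - shrange u t.
  rewrite /p (shift_range_id F Ef (@frame_sunit _ _ _ X)).
  by rewrite -[LHS]/(-1 *: shrange u t + t) scaleN1r addrC.
have Ap : toeplitz p by exact: (cstar_memL AP).
have pip k : pi p k = k - rep_range XH T 1 k.
  rewrite (cstar_repL piP) // (piQ _ _ uF) (piQ _ _ (@frame_sunit _ _ _ X)).
  rewrite -[LHS]/(-1 *: rep_range XH T 1 k + rep_range XH T 0 k).
  by rewrite scaleN1r addrC rep_range0.
have comp : p \o (adj (shift x) \o (shift x \o p)) = `|x| ^+ 2 *: p.
  apply/funext => t /=; have /= := vacuum_compression Ef x t uF.
  by rewrite -!pE => ->.
clearbody p.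
have A1 : toeplitz (shift x \o p) := cstar_memM AP (AS n x) Ap.
have A2 : toeplitz (adj (shift x)) := cstar_mem_adj AP (AS n x).
have := congr1 pi comp; rewrite (cstar_repZ AP piP _ Ap).
rewrite (cstar_repM piP Ap (cstar_memM AP A2 A1)) (cstar_repM piP A2 A1).
rewrite (cstar_repM piP (AS n x) Ap) (cstar_rep_adj piP (AS n x)) piT.
move=> /(congr1 (@^~ h)) e.
have {}e : pi p (adj (T x) (T x (pi p h))) = `|x| ^+ 2 *: pi p h := e.
by move: e; rewrite !pip.
Qed.

End Extension_to_relatively_isometric.

(** * The Wold decomposition *)

Section Relatively_isometric_to_extension.
Context {R : realType} {E : hilbertType R} {P : tensor_powers E}.
Context {X : subproduct_system P} {H : hilbertType R}.
Context (XH : forall n, hilbert_tensor (X n) H) (F : hilbert_sum X).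
Context (T : forall n, X n -> H -> H).
Hypotheses (Ef : finite_dim E) (TP : cc_covariant_representation T).
Hypothesis (TI : relatively_isometric XH T).

Local Notation shift x := (@fock_shift _ _ _ _ F _ x).
Local Notation tilde n := (@rep_tilde _ _ _ _ _ XH T n).
Local Notation Q := (rep_range XH T).
Local Notation D := (Delta_star XH T).

Let bT n (x : X n) : bounded_op (T x) := rep_bounded TP x.
Let TL n (x : X n) : linear (T x) := bounded_op_linear (bT x).

Lemma rel_rep_range_idem n h : Q n (Q n h) = Q n h.
Proof. by case: TI => Tp _; exact: partial_isometryK. Qed.

Lemma rel_DeltaE h : D h = h - Q 1 h.
Proof. by rewrite (Delta_starE Ef TP) //; exact: rel_rep_range_idem. Qed.

Lemma rel_Delta_selfadj h k : inner (D h) k = inner h (D k).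
Proof. by rewrite !rel_DeltaE innerBl innerBr rep_range_selfadj. Qed.

Lemma rel_Delta_idem h : D (D h) = D h.
Proof.
rewrite !rel_DeltaE (linfunB (bounded_op_linear (bounded_rep_range XH Ef TP 1))).
by rewrite rel_rep_range_idem subrr subr0.
Qed.

(** Conditions (a) and (b) merge here: each places x (x) Delta h in the initial space of T~_n, (a)
    as a value of T~_n^* and (b) because T~_n preserves its norm. *)
Lemma rel_tilde_initial n (x : X n) h :
  adj (tilde n) (T x (D h)) = tens (XH n) x (D h).
Proof.
have [Tp Tab] := TI; have b := bounded_rep_tilde XH Ef TP n.
rewrite -(rep_tilde_tens XH Ef TP).
case: Tab => [Ta|Tb].
  have [|t _ <-] := Ta n (tens (XH n) x (D h)).
    by apply: sub_closed_span; exists x, h.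
  apply: inner_inj => z.
  rewrite -[LHS]inner_adj // -[LHS]adj_inner // -[LHS]inner_adj //.
  by rewrite partial_isometryK // inner_adj.
apply: partial_isometry_initial => //.
rewrite rep_tilde_tens // norm_tens; apply/eqP.
rewrite -(@eqrXn2 _ 2) ?mulr_ge0 // exprMn -!inner_norm (inner_adj (bT x)).
(* Writing the left Delta h as Delta Delta h and moving one Delta across produces exactly the left
   side of (b). *)
rewrite -[D h in X in inner X _]rel_Delta_idem rel_Delta_selfadj Tb innerZr.
by rewrite [inner x x]inner_norm.
Qed.

(** Only the right vector has to lie in Im Delta, since T~_n^* T~_n fixes x (x) Delta k. The freedom
    in h is what [rel_orthogonal] exploits. *)
Lemma rel_inner n (u x : X n) h k :
  inner (T u h) (T x (D k)) = inner u x * inner h (D k).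
Proof.
rewrite -(rep_tilde_tens XH Ef TP u) inner_adj; last exact: bounded_rep_tilde.
by rewrite rel_tilde_initial tens_inner.
Qed.

(** Delta is the projection complementary to the range of T~_1, and a product frame of X(1) and X(n)
    factors T_(n+1) through T_1. *)
Lemma rel_Delta_orth n (x : X n.+1) h k : inner (T x h) (D k) = 0.
Proof.
have b := bounded_rep_tilde XH Ef TP 1; have [Tp _] := TI.
have h1 (y : X 1%N) g : inner (T y g) (D k) = 0.
  rewrite -(rep_tilde_tens XH Ef TP y g) rel_DeltaE innerBr /rep_range.
  by rewrite -[X in _ - X]adj_inner // -[X in _ - X]inner_adj // partial_isometryK // subrr.
have [u uF] := frame_exists X 1 Ef; have [v vF] := frame_exists X n Ef.
rewrite (rep_frame TP _ _ (frame_smul (n := 1) uF vF)) big_allpairs_dep.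
rewrite inner_suml big1 // => e _.
rewrite inner_suml big1 // => f _.
by rewrite innerZl (rep_smul TP) h1 mulr0.
Qed.

Lemma rel_orthogonal n m (x : X n) (y : X m) h k : n <> m ->
  inner (T x (D h)) (T y (D k)) = 0.
Proof.
have lt n' m' (x' : X n') (y' : X m') h' k' : (n' < m')%N ->
    inner (T y' (D k')) (T x' (D h')) = 0.
  (* The larger degree is split as n' plus a syntactic successor: [rel_inner] strips the degree n',
     and the rest has the positive degree required by [rel_Delta_orth]. *)
  move=> nm; move: y'; rewrite -(subnKC nm) addSnnS => y'.
  have [u uF] := frame_exists X n' Ef; have [v vF] := frame_exists X (m' - n'.+1).+1 Ef.
  rewrite (rep_frame TP _ _ (frame_smul uF vF)) big_allpairs_dep inner_suml big1 // => e _.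
  rewrite inner_suml big1 // => f _.
  by rewrite innerZl (rep_smul TP) rel_inner rel_Delta_orth !mulr0.
move=> /eqP; rewrite neq_ltn => /orP[nm|mn]; last exact: lt.
by rewrite inner_conj lt // conjC0.
Qed.

Lemma wold_exists h : exists W : F -> H, bounded_op W /\
  forall n (x : X n), W (hs_in F x) = T x (D h).
Proof.
apply: (hilbert_sum_extension F (f := fun n x => T x (D h)) (C := `|D h|)) => //.
- by move=> n c x y; exact: (repZD TP).
- move=> n x; rewrite -(@ler_pXn2r _ 2) ?nnegrE ?mulr_ge0 // exprMn -!inner_norm.
  by rewrite rel_inner mulrC.
- by move=> n m x y nm; exact: rel_orthogonal.
Qed.

(* [wold h t] is W(t (x) Delta h), so that no tensor product of F_X with the
   range of Delta is needed. *)
Definition wold h : F -> H := xget (fun=> 0) [set W : F -> H |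
  bounded_op W /\ forall n (x : X n), W (hs_in F x) = T x (D h)].

Lemma wold_spec h : bounded_op (wold h) /\
  forall n (x : X n), wold h (hs_in F x) = T x (D h).
Proof.
exact: (@xgetPex _ (fun=> 0) [set W : F -> H |
  bounded_op W /\ forall n (x : X n), W (hs_in F x) = T x (D h)] (wold_exists h)).
Qed.

Lemma bounded_wold h : bounded_op (wold h).
Proof. by case: (wold_spec h). Qed.

Lemma wold_in h n (x : X n) : wold h (hs_in F x) = T x (D h).
Proof. by case: (wold_spec h). Qed.

(** This is the isometry of W on F_X (x) Im Delta. It follows from comparing the adjoint of [wold h]
    composed with [wold k] to a scalar operator on homogeneous vectors. *)
Lemma inner_wold h k (s t : F) :
  inner (wold h s) (wold k t) = inner (D h) (D k) * inner s t.
Proof.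
have bh := bounded_wold h; have bk := bounded_wold k.
have e : adj (wold h) \o wold k = fun t => inner (D h) (D k) *: t.
  apply: hs_bounded_op_eq => [||n x].
  - exact: (bounded_op_comp (bounded_adj bh) bk).
  - exact: (bounded_opZ _ (bounded_op_id F)).
  apply: hs_inner_inj => m z /=; rewrite -inner_adj // !wold_in innerZr.
  have [nm|nm] := eqVneq m n.
    by subst m; rewrite rel_inner inner_hs_in mulrC.
  by rewrite rel_orthogonal ?hs_in_orthogonal ?mulr0 //; exact/eqP.
rewrite inner_adj // -[adj _ _]/((adj (wold h) \o wold k) t) e.
by rewrite innerZr.
Qed.

Hypothesis (Tpure : pure_rep XH T).

Lemma wold_total : closed_span [set y | exists p, y = wold p.1 p.2] = setT.
Proof.
apply/seteqP; split=> // h _; set S := closed_span _.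
have SS : closed_subspace S := closed_span_subspace _.
have SW k t : S (wold k t) by apply: sub_closed_span; exists (k, t).
(* The difference is the sum over e of T_n(e) Delta T_n(e)^* h, and each term is the value of [wold]
   for T_n(e)^* h at the vector e of X(n). *)
have step n : S (Q n h - Q n.+1 h).
  have [u uF] := frame_exists X n Ef.
  rewrite (rep_rangeE XH Ef TP _ uF) (rep_rangeS XH Ef TP _ uF) -sumrB.
  apply: (@closed_subspace_sum _ _ S _ u _ SS) => e.
  by rewrite -(linfunB (TL e)) -rel_DeltaE -wold_in.
have SQ n : S (h - Q n h).
  elim: n => [|n IH]; first by rewrite rep_range0 // subrr; case: SS.
  by rewrite -(subrKA (Q n h)); exact: (closed_subspaceD SS IH (step n)).
have [_ _ /closedP Scl] := SS; apply: (Scl h) => e e0.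
(* The distance from h to h - Q N h is |Q N h|, which pureness makes small. *)
have /cvgrPdist_lt/(_ e e0)[N _ hN] := Tpure h.
exists (h - Q N h); first exact: SQ.
by have := hN N (leqnn N); rewrite /= sub0r normrN opprB addrC subrK.
Qed.

Let wv (p : H * F) := wold p.1 p.2.

(** After orthonormalizing the finitely many vectors Delta h_p, the squared norm of a combination
    splits into a sum over e of squared norms in F_X. The operator a acts on each of these vectors
    separately, so its own bound M suffices. *)
Lemma wold_act_exists (a : F -> F) : bounded_op a ->
  exists b : H -> H, bounded_op b /\ forall p, b (wv p) = wold p.1 (a p.2).
Proof.
move=> ab; have [aL [M M0 aM]] := (bounded_opP a).1 ab.
apply: (@bounded_extension _ _ _ _ wv (fun p => wold p.1 (a p.2)) M M0 wold_total) => s.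
have [u uP] := gram_schmidt [seq D p.2.1 | p <- s].
have normE (g : F -> F) : linear g -> `|lincomb (fun p => wold p.1 (g p.2)) s| ^+ 2 =
    \sum_(e <- u) `|\sum_(p <- s) inner e (D p.2.1) *: g (p.1 *: p.2.2)| ^+ 2.
  move=> gL; rewrite -(gram_sum (d := fun p => D p.2.1)); last first.
    by move=> p ps; apply: uP; exact: (map_f (fun p => D p.2.1)).
  rewrite -inner_norm inner_suml; apply: eq_bigr => p _.
  rewrite inner_sumr; apply: eq_bigr => q _.
  by rewrite innerZl innerZr inner_wold !(linfunZ gL) innerZl innerZr; ring.
rewrite -(@ler_pXn2r _ 2) ?nnegrE ?mulr_ge0 // exprMn.
rewrite (normE a aL) (normE idfun) // mulr_sumr; apply: ler_sum => e _.
rewrite -exprMn ler_pXn2r ?nnegrE ?mulr_ge0 //.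
apply: le_trans (aM _); rewrite (linfun_sum aL) le_eqVlt; apply/orP; left.
apply/eqP; congr (`|_|); apply: eq_bigr => p _.
by rewrite [RHS](linfunZ aL).
Qed.

(* W (a (x) I) W^*. *)
Definition wold_rep (a : F -> F) : H -> H := xget (fun=> 0)
  [set b : H -> H | bounded_op b /\ forall p, b (wv p) = wold p.1 (a p.2)].

Lemma wold_rep_spec (a : F -> F) : bounded_op a ->
  bounded_op (wold_rep a) /\ forall h t, wold_rep a (wold h t) = wold h (a t).
Proof.
move=> /wold_act_exists ex.
have [b0 bP] := @xgetPex _ (fun=> 0) [set b : H -> H | bounded_op b /\
  forall p, b (wv p) = wold p.1 (a p.2)] ex.
by split=> // h t; exact: (bP (h, t)).
Qed.

(** The algebraic laws of the representation reduce through this to identities on the vectors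
    [wold h t], where a acts on t alone. *)
Lemma wold_rep_unique (a : F -> F) (b : H -> H) : bounded_op a -> bounded_op b ->
  (forall h t, b (wold h t) = wold h (a t)) -> wold_rep a = b.
Proof.
move=> ab bb h; have [pb pP] := wold_rep_spec ab.
by apply: (bounded_op_eq wold_total pb bb) => _ [[k t] ->] /=; rewrite pP h.
Qed.

Lemma relatively_isometric_extension : extends_to_cstar_representation F T.
Proof.
have AP : cstar_subalgebra (@toeplitz _ _ _ _ F) := toeplitz_subalgebra F.
have [Ab _ _ _ _] := AP.
have piT n (x : X n) : wold_rep (shift x) = T x.
  apply: wold_rep_unique => // [|h t]; first exact: bounded_fock_shift.
  have b := bounded_wold h.
  (* W intertwines S_n(x) with T_n(x); on homogeneous vectors this is multiplicativity of T. *)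
  apply: (congr1 (@^~ t)
    (_ : T x \o wold h = wold h \o shift x)).
  apply: hs_bounded_op_eq => [||m y /=].
  - exact: bounded_op_comp.
  - by apply: (bounded_op_comp b); exact: bounded_fock_shift.
  - by rewrite fock_shift_in !wold_in (rep_smul TP).
exists wold_rep; split=> //; split.
- by move=> a /Ab/wold_rep_spec[].
- move=> c a b /Ab ab /Ab bb.
  have [pa paP] := wold_rep_spec ab; have [pb pbP] := wold_rep_spec bb.
  apply: wold_rep_unique; [exact: bounded_op_lincomb|exact: bounded_op_lincomb|].
  move=> h t; rewrite -[LHS]/(c *: wold_rep a _ + wold_rep b _) paP pbP.
  by rewrite -[(_ + b) t]/(c *: a t + b t) (bounded_op_linear (bounded_wold h)).
- move=> a b /Ab ab /Ab bb.
  have [pa paP] := wold_rep_spec ab; have [pb pbP] := wold_rep_spec bb.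
  apply: wold_rep_unique; [exact: bounded_op_comp|exact: bounded_op_comp|].
  by move=> h t /=; rewrite pbP paP.
- move=> a /Ab ab; have [pa paP] := wold_rep_spec ab.
  apply: wold_rep_unique; [exact: bounded_adj|exact: bounded_adj|].
  move=> h t; apply: (inner_inj_total wold_total) => _ [[k s] ->] /=.
  by rewrite -inner_adj // paP !inner_wold (inner_adj ab).
- apply/seteqP; split=> // h _; apply: sub_closed_span.
  (* Nondegeneracy: S_0(1) is sent to T_0(1) = I, so every h is already a value. *)
  exists (shift (sunit X)), h; split; first exact: toeplitz_shift.
  by rewrite piT (rep_sunit TP).
Qed.

End Relatively_isometric_to_extension.

Theorem corollary3p10 (R : realType) (E : hilbertType R)
    (P : tensor_powers E) (X : subproduct_system P)
    (H : hilbertType R) (XH : forall n, hilbert_tensor (X n) H)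
    (F : hilbert_sum X) (T : forall n, X n -> H -> H) :
  finite_dim E ->
  cc_covariant_representation T ->
  pure_rep XH T ->
  (extends_to_cstar_representation F T <-> relatively_isometric XH T).
Proof.
move=> Ef TP Tpure; split; first exact: extension_relatively_isometric.
by move=> TI; exact: relatively_isometric_extension TI Tpure.
Qed.
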